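(* Let $\mathbf{X}$ be a represented space. The following are equivalent: 1. There exists a c.e. transitive relation $\prec\ \subseteq \mathbb{N}\times\mathbb{N}$ such that $\mathbf{X}$ is computably isomorphic to $\mathrm{RI}(\prec)$. 2. $\mathbf{X}$ is computably isomorphic to a $\Pi^0_2$-subspace of $\mathcal{O}(\mathbb{N})$. 3. $\mathbf{X}$ admits an effectively fiber-overt computably admissible representation $\delta$ such that $\mathrm{dom}(\delta)\subseteq\mathbb{N}^{\mathbb{N}}$ is $\Pi^0_2$.
   Context: A represented space $\mathbf{X}=(X,\delta_X)$ is a set $X$ with a partial surjection $\delta_X:\subseteq\mathbb{N}^{\mathbb{N}}\to X$ (if $\delta_X(p)=x$, $p$ is a name of $x$). A realizer of a partial multivalued function $f:\subseteq\mathbf{X}\rightrightarrows\mathbf{Y}$ is a partial $F:\subseteq\mathbb{N}^{\mathbb{N}}\to\mathbb{N}^{\mathbb{N}}$ with $\delta_Y(F(p))\in f(\delta_X(p))$ for all $p\in\mathrm{dom}(f\circ\delta_X)$; $f$ is computable (continuous) if it has a computable (continuous) realizer. A computable isomorphism is a computable bijection with computable inverse. That $\mathbf{X}$ admits a representation $\delta$ with given properties means that there is a representation $\delta$ of the set $X$ with these properties such that the identity between $(X,\delta_X)$ and $(X,\delta)$ is a computable isomorphism. A subspace of a represented space carries the restricted representation. Sierpinski space $\Sigma$ is $\{\top,\bot\}$ represented by $\delta_\Sigma:\mathbb{N}^{\mathbb{N}}\to\{\top,\bot\}$ with $\delta_\Sigma(p)=\bot$ iff $p=0^\omega$. $\mathcal{O}(\mathbf{X})$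 is the represented space of the open sets $U\subseteq X$ (those open in the final topology of $\delta_X$), each identified with its continuous characteristic function $\chi_U:\mathbf{X}\to\Sigma$ in the function space $\mathcal{C}(\mathbf{X},\Sigma)$ (represented via a universal machine with oracle, so that evaluation and currying are computable). In particular, $\mathcal{O}(\mathbb{N})$ is the set of all subsets of $\mathbb{N}$, represented by enumerations (with the Scott topology). $\mathcal{V}(\mathbf{X})$ is the represented space of closed subsets $A$ of $\mathbf{X}$, where $A$ is identified with $\{U\in\mathcal{O}(\mathbf{X})\mid U\cap A\neq\emptyset\}\in\mathcal{O}(\mathcal{O}(\mathbf{X}))$. For a transitive relation $\prec$ on $\mathbb{N}$, $I\subseteq\mathbb{N}$ is a rounded ideal if (i) $I\neq\emptyset$; (ii) $y\in I$ and $x\prec y$ imply $x\in I$; (iii) for all $x,y\in I$ there is $z\in I$ with $x\prec z$ and $y\prec z$. $\mathrm{RI}(\prec)\subseteq\mathcal{O}(\mathbb{N})$ is the subspace of all rounded ideals. A $\Pi^0_2$-subset (lightface) of $\mathbf{Z}=\mathcal{O}(\mathbb{N})$ or $\mathbf{Z}=\mathbb{N}^{\mathbb{N}}$ is a set of the form $\{z\mid\forall n\ (z\in U_n\Rightarrow z\in V_n)\}$ for computable sequences $(U_n)_n,(V_n)_n$ in $\mathcal{O}(\mathbf{Z})$. A representation $\delta$ of $\mathbf{X}$ is effectively fiber-overt if $x\mapsto\overline{\delta^{-1}(\{x\})}:\mathbf{X}\to\mathcal{V}(\mathbb{N}^{\mathbb{N}})$ is computable. It is computably admissible if, for $\mathbf{X}=(X,\delta)$,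 the computable map $x\mapsto\{U\in\mathcal{O}(\mathbf{X})\mid x\in U\}:\mathbf{X}\to\mathcal{O}(\mathcal{O}(\mathbf{X}))$ is injective with computable partial inverse. *)

(* Defs.v *)
(* Sets are predicates; classical logic and extensionality are used freely. *)
From Stdlib Require Import Arith Lia Cantor.
From Stdlib Require Import Classical ClassicalEpsilon.
From Stdlib Require Import FunctionalExtensionality PropExtensionality ProofIrrelevance.

#[local] Arguments to_nat : simpl never.
#[local] Arguments of_nat : simpl never.

Definition baire := nat -> nat.

Definition agree (n : nat) (p q : baire) : Prop := forall i, i < n -> p i = q i.

(* Codes of mu-recursive functions of one argument with an oracle; several
   arguments are passed through the Cantor pairing. *)
Inductive code : Type :=
| Zero | Succ | Left | Right | Oracle
| Pair (f g : code)
| Comp (f g : code)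
| Prec (f g : code)
| Rfind (f : code).

(* [eval p c n m]: the program [c] with oracle [p] halts on [n] with value [m].
   [Prec f g] sends <a,0> to f(a) and <a,k+1> to g<a,<k,r>>, where r is its value
   at <a,k>; [Rfind f] sends n to the least m with f<n,m> = 0, provided that
   f<n,k> is defined for all k < m. *)
Fixpoint eval (p : baire) (c : code) : nat -> nat -> Prop :=
  match c with
  | Zero => fun _ m => m = 0
  | Succ => fun n m => m = S n
  | Left => fun n m => m = fst (of_nat n)
  | Right => fun n m => m = snd (of_nat n)
  | Oracle => fun n m => m = p n
  | Pair f g => fun n m =>
      exists a b, eval p f n a /\ eval p g n b /\ m = to_nat (a, b)
  | Comp f g => fun n m => exists k, eval p g n k /\ eval p f k m
  | Prec f g => fun n m =>
      let a := fst (of_nat n) in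
      nat_rect (fun _ => nat -> Prop) (eval p f a)
        (fun k R s => exists r, R r /\ eval p g (to_nat (a, to_nat (k, r))) s)
        (snd (of_nat n)) m
  | Rfind f => fun n m =>
      eval p f (to_nat (n, m)) 0 /\
      forall k, k < m -> exists v, eval p f (to_nat (n, k)) (S v)
  end.

(* Goedel numbering: <t,a> codes a constructor [t] with (paired) arguments [a].
   The fuel [S n] always suffices, see [decode_encode]. *)
Fixpoint decode_fuel (fuel n : nat) : code :=
  match fuel with
  | 0 => Zero
  | S k =>
      let (t, a) := of_nat n in
      let (a1, a2) := of_nat a in
      match t with
      | 0 => Zero
      | 1 => Succ
      | 2 => Left
      | 3 => Right
      | 4 => Oracle
      | 5 => Pair (decode_fuel k a1) (decode_fuel k a2)
      | 6 => Comp (decode_fuel k a1) (decode_fuel k a2)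
      | 7 => Prec (decode_fuel k a1) (decode_fuel k a2)
      | _ => Rfind (decode_fuel k a)
      end
  end.

Definition decode (n : nat) : code := decode_fuel (S n) n.

Fixpoint encode (c : code) : nat :=
  match c with
  | Zero => to_nat (0, 0)
  | Succ => to_nat (1, 0)
  | Left => to_nat (2, 0)
  | Right => to_nat (3, 0)
  | Oracle => to_nat (4, 0)
  | Pair f g => to_nat (5, to_nat (encode f, encode g))
  | Comp f g => to_nat (6, to_nat (encode f, encode g))
  | Prec f g => to_nat (7, to_nat (encode f, encode g))
  | Rfind f => to_nat (8, encode f)
  end.

Lemma decode_fuel_encode c : forall k, encode c < k -> decode_fuel k (encode c) = c.
Proof.
  induction c; intros [|k] Hk; try lia; cbn in *;
    rewrite ?cancel_of_to.
  1-5: reflexivity.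
  1-3: pose proof (to_nat_non_decreasing (encode c1) (encode c2));
    match type of Hk with to_nat (?t, ?a) < _ =>
      pose proof (to_nat_non_decreasing t a) end;
    rewrite IHc1, IHc2 by lia; reflexivity.
  pose proof (to_nat_non_decreasing 8 (encode c)).
  destruct (of_nat (encode c)) eqn:E.
  rewrite IHc by lia. reflexivity.
Qed.

Lemma decode_encode c : decode (encode c) = c.
Proof. apply decode_fuel_encode; lia. Qed.

Lemma eval_fun p c : forall n m m', eval p c n m -> eval p c n m' -> m = m'.
Proof.
  induction c; cbn; intros n m m' H H'; try congruence.
  - destruct H as (a & b & Ha & Hb & ->), H' as (a' & b' & Ha' & Hb' & ->).
    rewrite (IHc1 _ _ _ Ha Ha'), (IHc2 _ _ _ Hb Hb'). reflexivity.
  - destruct H as (k & Hk & H), H' as (k' & Hk' & H').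
    rewrite (IHc2 _ _ _ Hk Hk') in H. eauto.
  - revert m m' H H'. induction (snd (of_nat n)) as [|k IHk]; cbn; intros m m' H H'.
    + eauto.
    + destruct H as (r & Hr & H), H' as (r' & Hr' & H').
      rewrite (IHk _ _ Hr Hr') in H. eauto.
  - destruct H as [H0 H], H' as [H0' H'].
    destruct (Nat.lt_trichotomy m m') as [L | [E | L]]; [|exact E|].
    + destruct (H' _ L) as [v Hv]. discriminate (IHc _ _ _ H0 Hv).
    + destruct (H _ L) as [v Hv]. discriminate (IHc _ _ _ H0' Hv).
Qed.

Lemma agree_mono n m p q : n <= m -> agree m p q -> agree n p q.
Proof. intros L H i Hi. apply H. lia. Qed.

Lemma eval_use p c : forall n m, eval p c n m ->
  exists N, forall p', agree N p p' -> eval p' c n m.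
Proof.
  induction c; cbn; intros n m H; try (exists 0; intros; assumption).
  - exists (S n). intros p' A. rewrite H. apply A. lia.
  - destruct H as (a & b & Ha & Hb & ->).
    destruct (IHc1 _ _ Ha) as [N1 H1], (IHc2 _ _ Hb) as [N2 H2].
    exists (N1 + N2). intros p' A. exists a, b.
    repeat split; [apply H1 | apply H2]; apply (agree_mono _ (N1 + N2)); trivial; lia.
  - destruct H as (k & Hk & H).
    destruct (IHc2 _ _ Hk) as [N1 H1], (IHc1 _ _ H) as [N2 H2].
    exists (N1 + N2). intros p' A. exists k.
    split; [apply H1 | apply H2]; apply (agree_mono _ (N1 + N2)); trivial; lia.
  - revert m H. induction (snd (of_nat n)) as [|k IHk]; cbn; intros m H; [eauto|].
    destruct H as (r & Hr & H).
    destruct (IHk _ Hr) as [N1 H1], (IHc2 _ _ H) as [N2 H2].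
    exists (N1 + N2). intros p' A. exists r.
    split; [apply H1 | apply H2]; apply (agree_mono _ (N1 + N2)); trivial; lia.
  - destruct H as [H0 H]. destruct (IHc _ _ H0) as [N0 HN0].
    assert (exists N, forall p', agree N p p' ->
      forall k, k < m -> exists v, eval p' c (to_nat (n, k)) (S v)) as [N HN].
    { clear H0 HN0. induction m as [|m IHm]; [exists 0; intros; lia|].
      destruct IHm as [N1 H1]; [intros k L; apply H; lia|].
      destruct (H m) as [v Hv]; [lia|]. destruct (IHc _ _ Hv) as [N2 H2].
      exists (N1 + N2). intros p' A k L.
      destruct (Nat.eq_dec k m) as [->|].
      - exists v. apply H2, (agree_mono _ (N1 + N2)); trivial; lia.
      - apply H1; [apply (agree_mono _ (N1 + N2)); trivial; lia | lia]. }
    exists (N0 + N). intros p' A.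
    split; [apply HN0 | apply HN]; apply (agree_mono _ (N0 + N)); trivial; lia.
Qed.

(* The constant oracle 0 stands for "no oracle". *)
Definition ce (A : nat -> Prop) : Prop :=
  exists c, forall n, A n <-> exists m, eval (fun _ => 0) c n m.

Definition ce_rel (R : nat -> nat -> Prop) : Prop :=
  ce (fun n => R (fst (of_nat n)) (snd (of_nat n))).

(* A partial function is given by its graph. *)
Definition partial_fun (F : baire -> baire -> Prop) : Prop :=
  forall p q q', F p q -> F p q' -> q = q'.

Definition computable_baire (F : baire -> baire -> Prop) : Prop :=
  exists c, forall p q, F p q -> forall n, eval p c n (q n).

Definition continuous_baire (F : baire -> baire -> Prop) : Prop :=
  forall p q n, F p q ->
    exists m, forall p' q', F p' q' -> agree m p p' -> agree n q q'.

Definition join (p q : baire) : baire :=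
  fun n => if Nat.even n then p (Nat.div2 n) else q (Nat.div2 n).

(* The universal machine: [univ q p r] says that q = e q' computes r from p, i.e.
   that the machine number e with oracle <q',p> computes r. *)
Definition univ (q p r : baire) : Prop :=
  forall n, eval (join (fun k => q (S k)) p) (decode (q 0)) n (r n).

Lemma univ_fun q p r r' : univ q p r -> univ q p r' -> r = r'.
Proof.
  intros H H'. apply functional_extensionality. intros n.
  exact (eval_fun _ _ _ _ _ (H n) (H' n)).
Qed.

Record representation (X : Type) : Type := Representation {
  name :> baire -> X -> Prop;
  name_fun : forall p x y, name p x -> name p y -> x = y;
  name_surj : forall x, exists p, name p x
}.
Arguments Representation {X}.
Arguments name {X}.
Arguments name_fun {X}.
Arguments name_surj {X}.

Record repspace : Type := RepSpace {
  carrier :> Type;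
  delta : representation carrier
}.

Definition dom {X : Type} (d : representation X) (p : baire) : Prop :=
  exists x, d p x.

(* A partial multivalued function is given by its graph. *)
Definition realizes {X Y : repspace} (F : baire -> baire -> Prop)
    (f : X -> Y -> Prop) : Prop :=
  partial_fun F /\
  forall p x, delta X p x -> (exists y, f x y) ->
    exists q y, F p q /\ delta Y q y /\ f x y.

Definition computable_mv {X Y : repspace} (f : X -> Y -> Prop) : Prop :=
  exists F, computable_baire F /\ realizes F f.

Definition continuous_mv {X Y : repspace} (f : X -> Y -> Prop) : Prop :=
  exists F, continuous_baire F /\ realizes F f.

Definition computable {X Y : repspace} (f : X -> Y) : Prop :=
  computable_mv (fun x y => y = f x).

Definition continuous {X Y : repspace} (f : X -> Y) : Prop :=
  continuous_mv (fun x y => y = f x).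

Definition computable_iso {X Y : repspace} (f : X -> Y) : Prop :=
  computable f /\
  exists g : Y -> X,
    computable g /\ (forall x, g (f x) = x) /\ (forall y, f (g y) = y).

Definition isomorphic (X Y : repspace) : Prop :=
  exists f : X -> Y, computable_iso f.

Lemma sig_eq (T : Type) (P : T -> Prop) (u v : {x | P x}) :
  proj1_sig u = proj1_sig v -> u = v.
Proof.
  destruct u as [u Hu], v as [v Hv]; cbn; intros <-.
  f_equal. apply proof_irrelevance.
Qed.

Definition subspace (X : repspace) (P : X -> Prop) : repspace.
Proof.
  refine {| carrier := {x : X | P x};
    delta := Representation (fun p x => delta X p (proj1_sig x)) _ _ |}.
  - intros p x y Hx Hy. apply sig_eq. exact (name_fun _ _ _ _ Hx Hy).
  - intros x. apply name_surj.
Defined.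

Definition nat_space : repspace.
Proof.
  refine {| carrier := nat; delta := Representation (fun p n => n = p 0) _ _ |}.
  - congruence.
  - intros n. exists (fun _ => n). reflexivity.
Defined.

Definition baire_space : repspace.
Proof.
  refine {| carrier := baire; delta := Representation (fun p q => q = p) _ _ |}.
  - congruence.
  - eauto.
Defined.

(* The points are the propositions: [True] is top, [False] is bottom, and there
   are no others by excluded middle and propositional extensionality.  Thus a
   predicate is its own characteristic function. *)
Definition sierpinski : repspace.
Proof.
  refine {| carrier := Prop;
    delta := Representation (fun p (b : Prop) => ~ b <-> p = fun _ => 0) _ _ |}.
  - intros p a b Ha Hb. apply propositional_extensionality. tauto.
  - intros b. destruct (classic b) as [H | H].
    + exists (fun _ => 1). split; [tauto|].
      intros E. discriminate (f_equal (fun p => p 0) E).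
    + exists (fun _ => 0). tauto.
Defined.

Fixpoint prefix (p : baire) (k : nat) : nat :=
  match k with
  | 0 => 0
  | S k => S (to_nat (p k, prefix p k))
  end.

Lemma prefix_inj p q k l : prefix p k = prefix q l -> k = l /\ agree k p q.
Proof.
  revert l. induction k as [|k IH]; intros [|l] E; cbn [prefix] in E; try discriminate.
  - split; trivial. intros i Hi. lia.
  - injection E as E. apply to_nat_inj in E. injection E as E1 E2.
    destruct (IH _ E2) as [-> A]. split; trivial.
    intros i Hi. destruct (Nat.eq_dec i l) as [->|]; trivial. apply A. lia.
Qed.

Lemma agree_prefix p q k : agree k p q -> prefix p k = prefix q k.
Proof.
  induction k as [|k IH]; intros A; trivial. cbn [prefix].
  rewrite IH, (A k) by (try apply (agree_mono _ (S k)); trivial; lia). reflexivity.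
Qed.

Definition c_id := Pair Left Right.
Definition c_dbl :=
  Comp (Prec Zero (Comp Succ (Comp Succ (Comp Right Right)))) (Pair Zero c_id).
Definition c_prefix :=
  Comp
    (Prec Zero
       (Comp Succ
          (Pair (Comp Oracle (Comp Succ (Comp c_dbl (Comp Left Right))))
             (Comp Right Right))))
    (Pair Zero c_id).
(* On <n,k> queries the left half of the oracle at <n, prefix k of the right half>. *)
Definition c_assoc := Comp Oracle (Comp c_dbl (Pair Left (Comp c_prefix Right))).
Definition c_iszero := Comp (Prec (Comp Succ Zero) Zero) (Pair Zero c_id).
Definition c_pred := Comp (Prec Zero (Comp Left Right)) (Pair Zero c_id).
Definition c_main :=
  Comp c_pred (Comp c_assoc (Pair c_id (Rfind (Comp c_iszero c_assoc)))).

Lemma eval_id p n : eval p c_id n n.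
Proof.
  exists (fst (of_nat n)), (snd (of_nat n)). repeat split; cbn.
  rewrite <- surjective_pairing, cancel_to_of. reflexivity.
Qed.

Lemma eval_zero_id p n : eval p (Pair Zero c_id) n (to_nat (0, n)).
Proof. exists 0, n. repeat split. apply eval_id. Qed.

Lemma eval_dbl p n : eval p c_dbl n (2 * n).
Proof.
  exists (to_nat (0, n)). split; [apply eval_zero_id|].
  cbn -[Nat.mul]. rewrite cancel_of_to. cbn -[Nat.mul].
  induction n as [|n IH]; cbn -[Nat.mul]; [reflexivity|].
  exists (2 * n). split; [exact IH|].
  exists (S (2 * n)). split; [|lia]. exists (2 * n). split; [|reflexivity].
  exists (to_nat (n, 2 * n)). rewrite !cancel_of_to. split; reflexivity.
Qed.

Lemma join_even p q n : join p q (2 * n) = p n.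
Proof. unfold join. rewrite Nat.even_even, Nat.div2_double. reflexivity. Qed.

Lemma join_odd p q n : join p q (S (2 * n)) = q n.
Proof.
  unfold join. rewrite Nat.even_succ, <- Nat.negb_even, Nat.even_even.
  rewrite Nat.div2_succ_double. reflexivity.
Qed.

Lemma eval_prefix a p k : eval (join a p) c_prefix k (prefix p k).
Proof.
  exists (to_nat (0, k)). split; [apply eval_zero_id|].
  cbn -[prefix c_dbl]. rewrite cancel_of_to.
  cbn -[prefix c_dbl].
  induction k as [|k IH]; cbn -[c_dbl]; [reflexivity|].
  exists (prefix p k). split; [exact IH|].
  exists (to_nat (p k, prefix p k)). split; [|reflexivity].
  exists (p k), (prefix p k). repeat split.
  - exists (S (2 * k)). split; [|rewrite join_odd; reflexivity].
    exists (2 * k). split; [|reflexivity].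
    exists k. split; [|apply eval_dbl].
    exists (to_nat (k, prefix p k)). rewrite !cancel_of_to. split; reflexivity.
  - exists (to_nat (k, prefix p k)). rewrite !cancel_of_to. split; reflexivity.
Qed.

Lemma eval_assoc a p n k :
  eval (join a p) c_assoc (to_nat (n, k)) (a (to_nat (n, prefix p k))).
Proof.
  exists (2 * to_nat (n, prefix p k)). split.
  - exists (to_nat (n, prefix p k)). split; [|apply eval_dbl].
    exists n, (prefix p k). repeat split.
    + cbn. rewrite cancel_of_to. reflexivity.
    + exists k. split; [|apply eval_prefix].
      cbn. rewrite cancel_of_to. reflexivity.
  - cbn -[Nat.mul]. rewrite join_even. reflexivity.
Qed.

Lemma eval_iszero p n : eval p c_iszero n (match n with 0 => 1 | _ => 0 end).
Proof.
  exists (to_nat (0, n)). split; [apply eval_zero_id|].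
  cbn. rewrite cancel_of_to. cbn.
  induction n as [|n IH]; cbn.
  - exists 0. split; reflexivity.
  - eexists. split; [exact IH | reflexivity].
Qed.

Lemma eval_pred p n : eval p c_pred n (pred n).
Proof.
  exists (to_nat (0, n)). split; [apply eval_zero_id|].
  cbn. rewrite cancel_of_to. cbn.
  induction n as [|n IH]; cbn; [reflexivity|].
  exists (pred n). split; [exact IH|].
  exists (to_nat (n, pred n)). rewrite !cancel_of_to. split; reflexivity.
Qed.

Lemma eval_main a p n k v :
  a (to_nat (n, prefix p k)) = S v ->
  (forall j, j < k -> a (to_nat (n, prefix p j)) = 0) ->
  eval (join a p) c_main n v.
Proof.
  intros Hk Hj. exists (S v). split; [|apply eval_pred].
  exists (to_nat (n, k)). split; [|rewrite <- Hk; apply eval_assoc].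
  exists n, k. split; [apply eval_id|]. split; [|reflexivity]. split.
  - exists (S v). split; [rewrite <- Hk; apply eval_assoc|].
    exact (eval_iszero _ (S v)).
  - intros j L. exists 0, 0. split; [rewrite <- (Hj j L); apply eval_assoc|].
    exact (eval_iszero _ 0).
Qed.

Lemma least_witness (P : nat -> Prop) k :
  P k -> exists l, P l /\ forall j, j < l -> ~ P j.
Proof.
  induction k as [k IH] using lt_wf_ind. intros H.
  destruct (classic (exists j, j < k /\ P j)) as [(j & L & Hj) | N]; eauto.
  exists k. split; trivial. intros j L Hj. apply N. eauto.
Qed.

(* Every continuous partial function on Baire space is computed by the universal
   machine from some parameter. *)
Lemma univ_complete (F : baire -> baire -> Prop) :
  partial_fun F -> continuous_baire F ->
  exists q, forall p r, F p r -> univ q p r.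
Proof.
  intros HF HC.
  pose (good n s v := exists p r k,
    F p r /\ prefix p k = s /\ v = r n /\
    forall p' r', F p' r' -> agree k p p' -> r' n = v).
  assert (forall x, exists y,
    (y = 0 /\ forall v, ~ good (fst (of_nat x)) (snd (of_nat x)) v) \/
    (exists v, y = S v /\ good (fst (of_nat x)) (snd (of_nat x)) v)) as Hch.
  { intros x.
    destruct (classic (exists v, good (fst (of_nat x)) (snd (of_nat x)) v))
      as [[v Hv] | N].
    - exists (S v). right. eauto.
    - exists 0. left. split; trivial. intros v Hv. eauto. }
  pose (a x := proj1_sig (constructive_indefinite_description _ (Hch x))).
  assert (Ha : forall x,
    (a x = 0 /\ forall v, ~ good (fst (of_nat x)) (snd (of_nat x)) v) \/
    (exists v, a x = S v /\ good (fst (of_nat x)) (snd (of_nat x)) v)).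
  { intros x. unfold a. destruct constructive_indefinite_description as [y Hy].
    exact Hy. }
  clearbody a. clear Hch.
  exists (fun n => match n with 0 => encode c_main | S k => a k end).
  intros p r Hpr n. rewrite decode_encode.
  change (eval (join a p) c_main n (r n)).
  destruct (HC p r (S n) Hpr) as [k Hk].
  assert (Hnz : a (to_nat (n, prefix p k)) <> 0).
  { destruct (Ha (to_nat (n, prefix p k))) as [[_ N] | (v & -> & _)]; [|discriminate].
    rewrite cancel_of_to in N. cbn in N. exfalso. apply (N (r n)).
    exists p, r, k. repeat split; trivial.
    intros p' r' Hpr' A. symmetry. apply (Hk p' r' Hpr' A). lia. }
  destruct (least_witness (fun l => a (to_nat (n, prefix p l)) <> 0) k Hnz) as (l & Hl & Hmin).
  apply (eval_main a p n l).
  - destruct (Ha (to_nat (n, prefix p l))) as [[E _] | (v & E & G)]; [contradiction|].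
    rewrite E. f_equal. rewrite cancel_of_to in G. cbn in G.
    destruct G as (p0 & r0 & k0 & H0 & Epre & _ & Hv).
    destruct (prefix_inj _ _ _ _ Epre) as [-> A].
    symmetry. exact (Hv p r Hpr A).
  - intros j L. specialize (Hmin j L). destruct (a (to_nat (n, prefix p j))); trivial.
    exfalso. apply Hmin. discriminate.
Qed.

Definition funspace (X Y : repspace) : repspace.
Proof.
  refine {| carrier := {f : X -> Y | continuous f};
    delta := Representation
      (fun q f => forall p x, delta X p x ->
         exists r, univ q p r /\ delta Y r (proj1_sig f x)) _ _ |}.
  - intros q f g Hf Hg. apply sig_eq, functional_extensionality. intros x.
    destruct (name_surj (delta X) x) as [p Hp].
    destruct (Hf p x Hp) as (r & Hr & Hfx), (Hg p x Hp) as (r' & Hr' & Hgx).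
    rewrite (univ_fun _ _ _ _ Hr' Hr) in Hgx. exact (name_fun _ _ _ _ Hfx Hgx).
  - intros [f (F & HC & HP & HR)].
    destruct (univ_complete F HP HC) as [q Hq]. exists q. intros p x Hp.
    destruct (HR p x Hp (ex_intro _ _ eq_refl)) as (r & y & Hpr & Hy & ->). eauto.
Defined.

(* Openness in the final topology: the preimage is open in the domain of the
   representation. *)
Definition is_open (X : repspace) (U : X -> Prop) : Prop :=
  forall p x, delta X p x -> U x ->
    exists n, forall p' x', delta X p' x' -> agree n p p' -> U x'.

Definition is_closed (X : repspace) (A : X -> Prop) : Prop :=
  is_open X (fun x => ~ A x).

Definition closure (X : repspace) (A : X -> Prop) : X -> Prop :=
  fun x => forall U, is_open X U -> U x -> exists y, U y /\ A y.

Lemma closed_closure X A : is_closed X (closure X A).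
Proof.
  intros p x Hp N.
  apply not_all_ex_not in N as [U N].
  apply imply_to_and in N as [HU N]. apply imply_to_and in N as [Ux N].
  destruct (HU p x Hp Ux) as [n Hn]. exists n. intros p' x' Hp' A' C.
  exact (N (C U HU (Hn p' x' Hp' A'))).
Qed.

Lemma continuous_chi (X : repspace) (U : X -> Prop) :
  is_open X U -> continuous (X := X) (Y := sierpinski) U.
Proof.
  intros HU.
  pose (B p n := forall p' x', delta X p' x' -> agree n p p' -> U x').
  assert (HB : forall p p' n, agree n p p' -> B p n -> B p' n).
  { intros p p' n A H p'' x'' H'' A''. apply (H p'' x'' H'').
    intros i Hi. rewrite (A i Hi). exact (A'' i Hi). }
  pose (v p n := if excluded_middle_informative (B p n) then 1 else 0).
  exists (fun p q => q = v p). split.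
  - intros p q n ->. exists n. intros p' q' -> A i Hi. unfold v.
    assert (A' : agree i p p') by (apply (agree_mono _ n); trivial; lia).
    assert (A'' : agree i p' p) by (intros j Hj; symmetry; apply (A' j Hj)).
    destruct (excluded_middle_informative (B p i)),
      (excluded_middle_informative (B p' i)); trivial; exfalso; eauto.
  - split; [congruence|]. intros p x Hp _. exists (v p), (U x).
    repeat split; trivial.
    + intros N. apply functional_extensionality. intros n. unfold v.
      destruct (excluded_middle_informative (B p n)) as [b|]; trivial.
      exfalso. apply N, (b p x Hp). intros i _. reflexivity.
    + intros E Ux. destruct (HU p x Hp Ux) as [n Hn].
      apply (f_equal (fun q => q n)) in E. unfold v in E.
      destruct (excluded_middle_informative (B p n)); [discriminate | contradiction].
Qed.

Definition chi (X : repspace) (U : {U : X -> Prop | is_open X U}) :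
    funspace X sierpinski :=
  exist _ (proj1_sig U) (continuous_chi X _ (proj2_sig U)).

Definition opens (X : repspace) : repspace.
Proof.
  refine {| carrier := {U : X -> Prop | is_open X U};
    delta := Representation
      (fun q U => delta (funspace X sierpinski) q (chi X U)) _ _ |}.
  - intros q U V HU HV. apply sig_eq.
    exact (f_equal (@proj1_sig _ _) (name_fun _ _ _ _ HU HV)).
  - intros U. apply name_surj.
Defined.

Definition set_of {X : repspace} (U : opens X) : X -> Prop := proj1_sig U.

Lemma open_hit (X : repspace) (A : X -> Prop) :
  is_open (opens X) (fun U => exists x, set_of U x /\ A x).
Proof.
  intros q U HU (x & Ux & Ax).
  destruct (name_surj (delta X) x) as [p Hp].
  destruct (HU p x Hp) as (r & Hr & Hrx). cbn in Hrx.
  assert (exists n, r n <> 0) as [n Hn].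
  { apply not_all_not_ex. intros N. apply Hrx; trivial.
    apply functional_extensionality. intros n. apply NNPP, N. }
  destruct (eval_use _ _ _ _ (Hr n)) as [k Hk].
  exists (S k). intros q' V HV Aq. exists x. split; trivial.
  destruct (HV p x Hp) as (r' & Hr' & Hrx'). cbn in Hrx'.
  apply NNPP. intros N. apply Hrx' in N. apply Hn.
  assert (E : r n = r' n); [|rewrite E, N; reflexivity].
  apply (eval_fun (join (fun k => q' (S k)) p) (decode (q 0)) n).
  - apply Hk. intros i Hi. unfold join. destruct (Nat.even i); trivial.
    apply Aq. pose proof (Nat.div2_decr i i). lia.
  - rewrite (Aq 0) by lia. apply Hr'.
Qed.

Definition hit (X : repspace) (A : X -> Prop) : opens (opens X) :=
  exist _ _ (open_hit X A).

Lemma open_nbhds (X : repspace) (x : X) :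
  is_open (opens X) (fun U => set_of U x).
Proof.
  intros q U HU Ux.
  destruct (open_hit X (eq x) q U HU) as [n Hn]; [eauto|].
  exists n. intros q' V HV A. destruct (Hn q' V HV A) as (y & Vy & <-). exact Vy.
Qed.

Definition nbhds (X : repspace) (x : X) : opens (opens X) :=
  exist _ _ (open_nbhds X x).

Definition overt (X : repspace) : repspace.
Proof.
  refine {| carrier := {A : X -> Prop | is_closed X A};
    delta := Representation
      (fun q A => delta (opens (opens X)) q (hit X (proj1_sig A))) _ _ |}.
  - assert (sub : forall A B : {A : X -> Prop | is_closed X A},
      hit X (proj1_sig A) = hit X (proj1_sig B) ->
      forall x, proj1_sig A x -> proj1_sig B x).
    { intros A [B HB] E x Ax. cbn. apply NNPP. intros N.
      assert (H : set_of (hit X (proj1_sig A))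
        (exist (is_open X) (fun x => ~ B x) HB)) by (exists x; split; assumption).
      rewrite E in H. destruct H as (y & Ny & By). exact (Ny By). }
    intros q A B HA HB. pose proof (name_fun _ _ _ _ HA HB) as E.
    apply sig_eq, functional_extensionality. intros x.
    apply propositional_extensionality.
    split; apply sub; [exact E | symmetry; exact E].
  - intros A. apply name_surj.
Defined.

(* The set of all subsets of N, represented by enumerations; the shift by one
   allows for the empty set. *)
Definition opens_nat : repspace.
Proof.
  refine {| carrier := nat -> Prop;
    delta := Representation
      (fun p (A : nat -> Prop) => forall n, A n <-> exists k, p k = S n) _ _ |}.
  - intros p A B HA HB. apply functional_extensionality. intros n.
    apply propositional_extensionality. rewrite HA, HB. reflexivity.
  - intros A.
    exists (fun k => if excluded_middle_informative (A k) then S k else 0).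
    intros n. split.
    + intros H. exists n. destruct (excluded_middle_informative (A n)); tauto.
    + intros [k E]. destruct (excluded_middle_informative (A k)); [|discriminate].
      injection E as <-. assumption.
Defined.

Definition transitive_rel (R : nat -> nat -> Prop) : Prop :=
  forall x y z, R x y -> R y z -> R x z.

Definition rounded_ideal (R : nat -> nat -> Prop) (I : nat -> Prop) : Prop :=
  (exists x, I x) /\
  (forall x y, I y -> R x y -> I x) /\
  (forall x y, I x -> I y -> exists z, I z /\ R x z /\ R y z).

Definition RI (R : nat -> nat -> Prop) : repspace :=
  subspace opens_nat (rounded_ideal R).

Definition pi02 (Z : repspace) (P : Z -> Prop) : Prop :=
  exists U V : nat_space -> opens Z,
    computable U /\ computable V /\
    forall z, P z <-> forall n, set_of (U n) z -> set_of (V n) z.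

Definition fiber_closure {X : Type} (d : representation X) (x : X) :
    overt baire_space :=
  exist _ _ (closed_closure baire_space (fun p => d p x)).

Definition fiber_overt {X : Type} (d : representation X) : Prop :=
  computable (X := RepSpace X d) (fiber_closure d).

Definition computably_admissible {X : Type} (d : representation X) : Prop :=
  let Xd := RepSpace X d in
  (forall x y : Xd, nbhds Xd x = nbhds Xd y -> x = y) /\
  computable_mv (X := opens (opens Xd)) (Y := Xd) (fun W x => W = nbhds Xd x).

(* [d] is a representation of the space [X] itself: the identity is a computable
   isomorphism. *)
Definition admits (X : repspace) (d : representation X) : Prop :=
  computable_iso (X := X) (Y := RepSpace X d) (fun x => x).

(* Main.v *)
From Stdlib Require Import Arith Lia Cantor.
From Stdlib Require Import Classical ClassicalEpsilon.
From Stdlib Require Import FunctionalExtensionality PropExtensionality.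
Require Import Defs.

(* A set of the form [forall n, U_n -> V_n] in O(N) is given by conditions "if the finite
   set F_k is contained in A, then A meets V_k".  The tokens <F,m>, with F finite, are
   ordered by <F,m> < <F',m'> iff F is contained in F', m < m' and, for k < m, the
   condition k is satisfied in F' as soon as it is triggered by F; then A corresponds to
   the rounded ideal of all <F,m> with F contained in A.

   For a Pi^0_2 subspace of O(N), the enumerations of its points form the required
   representation: a finite sequence extends to an enumeration of A iff its entries are
   in A.  Conversely, given a representation, a point x is sent to the tree of all finite
   prefixes of its names.  Fiber overtness enumerates this tree, and admissibility recovers
   x from it, since x lies in an open set iff the set accepts some node of the tree.  The
   trees of points are characterised by Pi^0_2 conditions: if they hold, a generic branch
   (Baire category) is a name of a point with exactly the given tree.

   Everything rests on a universal machine: the evaluation relation with a partial oracle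
   is the least fixed point of a semidecidable rule, hence semidecidable. *)

#[local] Arguments to_nat : simpl never.
#[local] Arguments of_nat : simpl never.
#[local] Arguments decode : simpl never.

(** * Pairing and coded finite lists *)

Notation pr a b := (to_nat (a, b)).
Definition fstn (n : nat) : nat := fst (of_nat n).
Definition sndn (n : nat) : nat := snd (of_nat n).

Lemma fstn_pr a b : fstn (pr a b) = a.
Proof. unfold fstn. rewrite cancel_of_to. reflexivity. Qed.

Lemma sndn_pr a b : sndn (pr a b) = b.
Proof. unfold sndn. rewrite cancel_of_to. reflexivity. Qed.

Lemma pr_fstn_sndn n : pr (fstn n) (sndn n) = n.
Proof. unfold fstn, sndn. rewrite <- surjective_pairing. apply cancel_to_of. Qed.

Ltac prs := repeat rewrite ?fstn_pr, ?sndn_pr, ?pr_fstn_sndn in *.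

(* Lists are coded as in [prefix], with 0 for the empty list.  As in the names of
   [opens_nat], an entry [S y] stands for the element [y] and an entry 0 for nothing. *)
Definition cons (h t : nat) : nat := S (pr h t).
Definition hd (s : nat) : nat := fstn (pred s).
Definition tl (s : nat) : nat := sndn (pred s).
Definition drop (k s : nat) : nat := Nat.iter k tl s.
Definition els (s y : nat) : Prop := exists j, hd (drop j s) = S y.

Lemma hd_cons h t : hd (cons h t) = h.
Proof. apply fstn_pr. Qed.

Lemma tl_cons h t : tl (cons h t) = t.
Proof. apply sndn_pr. Qed.

Lemma cons_hd_tl s : s <> 0 -> cons (hd s) (tl s) = s.
Proof.
  intros H. unfold cons, hd, tl. rewrite pr_fstn_sndn. lia.
Qed.

Lemma tl_lt h t : t < cons h t.
Proof. unfold cons. pose proof (to_nat_non_decreasing h t). lia. Qed.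

Lemma coded_list_ind (P : nat -> Prop) :
  P 0 -> (forall h t, P t -> P (cons h t)) -> forall s, P s.
Proof.
  intros H0 HS s. induction s as [s IH] using lt_wf_ind.
  destruct (Nat.eq_dec s 0) as [-> | N]; trivial.
  rewrite <- (cons_hd_tl s N). apply HS, IH.
  pose proof (tl_lt (hd s) (tl s)) as L. rewrite (cons_hd_tl s N) in L. exact L.
Qed.

Lemma drop_tl j s : drop j (tl s) = drop (S j) s.
Proof. symmetry. apply Nat.iter_succ_r. Qed.

Lemma drop_0 j : drop j 0 = 0.
Proof.
  induction j as [|j IH]; [reflexivity|].
  change (tl (drop j 0) = 0). rewrite IH. reflexivity.
Qed.

Lemma els_nil y : ~ els 0 y.
Proof. intros [j H]. rewrite drop_0 in H. discriminate. Qed.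

Lemma els_cons h t y : els (cons h t) y <-> h = S y \/ els t y.
Proof.
  split.
  - intros [[|j] H].
    + left. rewrite <- H. symmetry. apply hd_cons.
    + right. exists j. rewrite <- drop_tl, tl_cons in H. exact H.
  - intros [-> | [j H]].
    + exists 0. apply hd_cons.
    + exists (S j). rewrite <- drop_tl, tl_cons. exact H.
Qed.

(** A tail has a smaller code than the whole list, so a list is no longer than its code. The code
    itself can therefore bound quantifiers over positions. *)
Lemma drop_ge s : forall j, s <= j -> drop j s = 0.
Proof.
  induction s as [|h t IH] using coded_list_ind; intros j L; [apply drop_0|].
  pose proof (tl_lt h t). destruct j as [|j]; [lia|].
  rewrite <- drop_tl, tl_cons. apply IH. lia.
Qed.

Lemma els_lt s y : els s y -> exists j, j < s /\ hd (drop j s) = S y.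
Proof.
  intros [j H]. exists j. split; trivial.
  destruct (Nat.lt_ge_cases j s) as [L | L]; trivial.
  rewrite drop_ge in H by trivial. discriminate.
Qed.

Lemma prefix_S p k : prefix p (S k) = cons (p k) (prefix p k).
Proof. reflexivity. Qed.

Lemma drop_prefix p j k : drop j (prefix p k) = prefix p (k - j).
Proof.
  revert k. induction j as [|j IH]; intros k.
  - rewrite Nat.sub_0_r. reflexivity.
  - rewrite <- drop_tl. destruct k as [|k].
    + exact (drop_0 j).
    + rewrite prefix_S, tl_cons. apply IH.
Qed.

Lemma els_prefix p k y : els (prefix p k) y <-> exists i, i < k /\ p i = S y.
Proof.
  induction k as [|k IH].
  - split; [intros H; destruct (els_nil _ H) | intros (i & L & _); lia].
  - rewrite prefix_S, els_cons, IH. split.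
    + intros [H | (i & L & H)]; [exists k | exists i]; split; trivial; lia.
    + intros (i & L & H). destruct (Nat.eq_dec i k) as [-> | N]; [tauto|].
      right. exists i. split; trivial. lia.
Qed.

Lemma prefix_extend s (q : baire) : exists p k, prefix p k = s /\ forall i, p (k + i) = q i.
Proof.
  induction s as [|h t (p & k & <- & H)] using coded_list_ind.
  - exists q, 0. split; reflexivity.
  - exists (fun i => if i <? k then p i else if i =? k then h else q (i - S k)), (S k).
    split.
    + rewrite prefix_S. f_equal.
      * rewrite Nat.ltb_irrefl, Nat.eqb_refl. reflexivity.
      * apply agree_prefix. intros i Hi. apply Nat.ltb_lt in Hi. rewrite Hi. reflexivity.
    + intros i. destruct (Nat.ltb_spec (S k + i) k); [lia|].
      destruct (Nat.eqb_spec (S k + i) k); [lia|]. f_equal. lia.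
Qed.

(** * Recursive functionals and semidecidable relations *)

(* These functionals are total on all oracles; unbounded search enters via [semidec]. *)
Definition recursive (F : baire -> nat -> nat) : Prop :=
  exists c, forall p n, eval p c n (F p n).

Fixpoint subst (c o : code) : code :=
  match c with
  | Oracle => o
  | Pair f g => Pair (subst f o) (subst g o)
  | Comp f g => Comp (subst f o) (subst g o)
  | Prec f g => Prec (subst f o) (subst g o)
  | Rfind f => Rfind (subst f o)
  | _ => c
  end.

Lemma eval_subst p q o c : (forall i, eval p o i (q i)) ->
  forall n m, eval q c n m -> eval p (subst c o) n m.
Proof.
  intros Ho. induction c; cbn; intros n m; trivial.
  - intros ->. apply Ho.
  - intros (a & b & Ha & Hb & ->). exists a, b. auto.
  - intros (k & Hk & H). exists k. auto.
  - revert m. induction (snd (of_nat n)) as [|k IHk]; cbn; intros m; [auto|].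
    intros (r & Hr & H). exists r. auto.
  - intros [H0 H]. split; [auto|]. intros k L. destruct (H k L) as [v Hv]. eauto.
Qed.

Lemma recursive_const k : recursive (fun _ _ => k).
Proof.
  induction k as [|k [c Hc]]; [exists Zero; reflexivity|].
  exists (Comp Succ c). intros p n. exists k. split; [apply Hc | reflexivity].
Qed.

Lemma recursive_id : recursive (fun _ n => n).
Proof. exists c_id. apply eval_id. Qed.

Lemma recursive_comp F G : recursive F -> recursive G -> recursive (fun p n => F p (G p n)).
Proof.
  intros [f Hf] [g Hg]. exists (Comp f g). intros p n. exists (G p n). auto.
Qed.

Lemma recursive_oracle F : recursive F -> recursive (fun p n => p (F p n)).
Proof. apply (recursive_comp (fun p n => p n)). exists Oracle. reflexivity. Qed.

Lemma recursive_S F : recursive F -> recursive (fun p n => S (F p n)).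
Proof. apply (recursive_comp (fun p n => S n)). exists Succ. reflexivity. Qed.

Lemma recursive_pred F : recursive F -> recursive (fun p n => pred (F p n)).
Proof. apply (recursive_comp (fun p n => pred n)). exists c_pred. apply eval_pred. Qed.

Lemma recursive_dbl F : recursive F -> recursive (fun p n => 2 * F p n).
Proof. apply (recursive_comp (fun p n => 2 * n)). exists c_dbl. apply eval_dbl. Qed.

Lemma recursive_fstn F : recursive F -> recursive (fun p n => fstn (F p n)).
Proof. apply (recursive_comp (fun p n => fstn n)). exists Left. reflexivity. Qed.

Lemma recursive_sndn F : recursive F -> recursive (fun p n => sndn (F p n)).
Proof. apply (recursive_comp (fun p n => sndn n)). exists Right. reflexivity. Qed.

Lemma recursive_pr F G : recursive F -> recursive G ->
  recursive (fun p n => pr (F p n) (G p n)).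
Proof.
  intros [f Hf] [g Hg]. exists (Pair f g). intros p n.
  exists (F p n), (G p n). auto.
Qed.

Lemma recursive_prim A B N :
  recursive A -> recursive (fun p z => B p (fstn z) (fstn (sndn z)) (sndn (sndn z))) ->
    recursive N ->
  recursive (fun p n => nat_rect (fun _ => nat) (A p n) (B p n) (N p n)).
Proof.
  intros [a Ha] [b Hb] HN.
  (* [Prec] carries one parameter, here the whole argument [n]; the recursion depth [N p n] is
     composed in afterwards. *)
  assert (H : recursive (fun p z =>
    nat_rect (fun _ => nat) (A p (fstn z)) (B p (fstn z)) (sndn z))).
  { exists (Prec a b). intros p n. cbn. fold (fstn n) (sndn n).
    induction (sndn n) as [|k IH]; cbn; [apply Ha|].
    eexists. split; [exact IH|].
    specialize (Hb p (pr (fstn n) (pr k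
      (nat_rect (fun _ => nat) (A p (fstn n)) (B p (fstn n)) k)))).
    prs. exact Hb. }
  pose proof (recursive_comp _ _ H (recursive_pr _ _ recursive_id HN)) as H'. cbn in H'.
  destruct H' as [c Hc]. exists c. intros p n. specialize (Hc p n). prs. exact Hc.
Qed.

(** Case distinction is a primitive recursion that ignores the recursive value. *)
Lemma recursive_case A B C : recursive A -> recursive B ->
  recursive (fun p z => C p (fstn z) (sndn z)) ->
  recursive (fun p n => match A p n with 0 => B p n | S k => C p n k end).
Proof.
  intros HA HB HC.
  destruct (recursive_prim B (fun p n k r => C p n k) A HB) as [c Hc]; trivial.
  - pose proof (recursive_comp _ (fun p z => pr (fstn z) (fstn (sndn z))) HC) as [c Hc].
    + apply recursive_pr; apply recursive_fstn; [|apply recursive_sndn];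
      apply recursive_id.
    + exists c. intros p n. specialize (Hc p n). prs. exact Hc.
  - exists c. intros p n. specialize (Hc p n). destruct (A p n); exact Hc.
Qed.

Lemma recursive_hd F : recursive F -> recursive (fun p n => hd (F p n)).
Proof. intros H. apply recursive_fstn, recursive_pred, H. Qed.

Lemma recursive_tl F : recursive F -> recursive (fun p n => tl (F p n)).
Proof. intros H. apply recursive_sndn, recursive_pred, H. Qed.

Lemma recursive_cons F G : recursive F -> recursive G ->
  recursive (fun p n => cons (F p n) (G p n)).
Proof. intros HF HG. apply recursive_S, recursive_pr; assumption. Qed.

Lemma recursive_drop F G : recursive F -> recursive G ->
  recursive (fun p n => drop (F p n) (G p n)).
Proof.
  intros HF HG. apply (recursive_prim G (fun p n k r => tl r) F); trivial.
  apply recursive_tl, recursive_sndn, recursive_sndn, recursive_id.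
Qed.

Lemma recursive_sub F G : recursive F -> recursive G -> recursive (fun p n => F p n - G p n).
Proof.
  intros HF HG. destruct (recursive_prim F (fun p n k r => pred r) G HF) as [c Hc]; trivial.
  - apply recursive_pred, recursive_sndn, recursive_sndn, recursive_id.
  - exists c. intros p n. specialize (Hc p n). cbn in Hc.
    replace (F p n - G p n) with
      (nat_rect (fun _ => nat) (F p n) (fun _ r => pred r) (G p n)); trivial.
    clear Hc.
    induction (G p n) as [|k IH]; cbn; [lia|]. rewrite IH. lia.
Qed.

Lemma recursive_subst F G : recursive F -> recursive G -> recursive (fun p n => G (F p) n).
Proof.
  intros [f Hf] [g Hg]. exists (subst g f). intros p n.
  apply (eval_subst p (F p)); auto.
Qed.

Lemma recursive_prefix F : recursive F -> recursive (fun p n => prefix p (F p n)).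
Proof.
  intros HF.
  destruct (recursive_prim (fun _ _ => 0) (fun p n k r => cons (p k) r) F) as [c Hc]; trivial.
  - apply recursive_const.
  - apply recursive_cons; [apply recursive_oracle, recursive_fstn|apply recursive_sndn];
    apply recursive_sndn, recursive_id.
  - exists c. intros p n. specialize (Hc p n).
    replace (prefix p (F p n)) with
      (nat_rect (fun _ => nat) 0 (fun k r => cons (p k) r) (F p n)); [exact Hc|].
    clear Hc. induction (F p n) as [|k IH]; cbn; [|rewrite IH]; reflexivity.
Qed.

(** Normal form of a relation c.e. in the oracle, uniformly in it: one unbounded search for a zero
    of a total functional. *)
Definition semidec (S : baire -> nat -> Prop) : Prop :=
  exists G, recursive G /\ forall p n, S p n <-> exists t, G p (pr n t) = 0.

Lemma semidec_ext S T : semidec S -> (forall p n, T p n <-> S p n) -> semidec T.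
Proof.
  intros (G & HG & H) E. exists G. split; trivial. intros p n. rewrite E. apply H.
Qed.

Lemma semidec_comp S F : semidec S -> recursive F -> semidec (fun p n => S p (F p n)).
Proof.
  intros (G & HG & H) HF. exists (fun p z => G p (pr (F p (fstn z)) (sndn z))). split.
  - apply (recursive_comp G); trivial. apply recursive_pr; [apply (recursive_comp F); trivial|];
    [apply recursive_fstn | apply recursive_sndn]; apply recursive_id.
  - intros p n. rewrite H. split; intros [t Ht]; exists t; prs; exact Ht.
Qed.

Lemma semidec_subst S F : semidec S -> recursive F -> semidec (fun p n => S (F p) n).
Proof.
  intros (G & HG & H) HF. exists (fun p z => G (F p) z). split.
  - apply recursive_subst; trivial.
  - intros p n. apply H.
Qed.

Lemma semidec_zero F : recursive F -> semidec (fun p n => F p n = 0).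
Proof.
  intros H. exists (fun p z => F p (fstn z)). split.
  - apply (recursive_comp F); trivial. apply recursive_fstn, recursive_id.
  - intros p n. split; [intros E; exists 0 | intros [t E]]; prs; exact E.
Qed.

Lemma semidec_le F G : recursive F -> recursive G -> semidec (fun p n => F p n <= G p n).
Proof.
  intros HF HG. apply (semidec_ext _ _ (semidec_zero _ (recursive_sub _ _ HF HG))).
  intros p n. lia.
Qed.

Lemma semidec_lt F G : recursive F -> recursive G -> semidec (fun p n => F p n < G p n).
Proof. intros HF HG. apply semidec_le; [apply recursive_S|]; assumption. Qed.

Lemma semidec_and S T : semidec S -> semidec T -> semidec (fun p n => S p n /\ T p n).
Proof.
  intros (G & HG & H) (G' & HG' & H').
  exists (fun p z => match G p (pr (fstn z) (fstn (sndn z))) with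
    0 => G' p (pr (fstn z) (sndn (sndn z))) | _ => 1 end). split.
  - apply recursive_case; [| |apply recursive_const]; apply recursive_comp; trivial;
    repeat first [apply recursive_pr | apply recursive_fstn | apply recursive_sndn
      | apply recursive_id].
  - intros p n. rewrite H, H'. split.
    + intros [[t Ht] [t' Ht']]. exists (pr t t'). prs. rewrite Ht. exact Ht'.
    + intros [t Ht]. prs. destruct G eqn:E; [|discriminate]. eauto.
Qed.

Lemma semidec_or S T : semidec S -> semidec T -> semidec (fun p n => S p n \/ T p n).
Proof.
  intros (G & HG & H) (G' & HG' & H').
  exists (fun p z => match fstn (sndn z) with
    0 => G p (pr (fstn z) (sndn (sndn z)))
  | _ => G' p (pr (fstn z) (sndn (sndn z))) end). split.
  - apply recursive_case; try apply recursive_comp; trivial;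
    repeat first [apply recursive_pr | apply recursive_fstn | apply recursive_sndn
      | apply recursive_id].
  - intros p n. rewrite H, H'. split.
    + intros [[t Ht] | [t Ht]]; [exists (pr 0 t) | exists (pr 1 t)]; prs; exact Ht.
    + intros [t Ht]. prs. destruct (fstn t); eauto.
Qed.

Lemma semidec_ex S : semidec (fun p z => S p (fstn z) (sndn z)) ->
  semidec (fun p n => exists x, S p n x).
Proof.
  intros (G & HG & H).
  exists (fun p z => G p (pr (pr (fstn z) (fstn (sndn z))) (sndn (sndn z)))). split.
  - apply recursive_comp; trivial.
    repeat first [apply recursive_pr | apply recursive_fstn | apply recursive_sndn
      | apply recursive_id].
  - intros p n. split.
    + intros [x Hx]. specialize (H p (pr n x)). prs. apply H in Hx as [t Ht].
      exists (pr x t). prs. exact Ht.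
    + intros [t Ht]. exists (fstn t). specialize (H p (pr n (fstn t))). prs.
      apply H. eauto.
Qed.

Lemma semidec_eq_nat F G : recursive F -> recursive G -> semidec (fun p n => F p n = G p n).
Proof.
  intros HF HG. eapply semidec_ext; [apply (semidec_and _ _ (semidec_le _ _ HF HG)
    (semidec_le _ _ HG HF))|].
  intros p n. cbn. lia.
Qed.

Lemma semidec_neq_nat F G : recursive F -> recursive G -> semidec (fun p n => F p n <> G p n).
Proof.
  intros HF HG. eapply semidec_ext; [apply (semidec_or _ _ (semidec_lt _ _ HF HG)
    (semidec_lt _ _ HG HF))|].
  intros p n. cbn. lia.
Qed.

(** One number codes the witnesses for all [x] below the bound. This moves an unbounded search in
    front of a bounded universal quantifier. *)
Lemma bounded_choice_list B : forall Q : nat -> nat -> Prop,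
  (forall x, x < B -> exists t, Q x t) ->
  exists w, forall x, x < B -> Q x (hd (drop x w)).
Proof.
  induction B as [|B IH]; intros Q H; [exists 0; intros; lia|].
  destruct (H 0) as [t Ht]; [lia|].
  destruct (IH (fun x => Q (S x))) as [w Hw]; [intros x L; apply H; lia|].
  exists (cons t w). intros [|x] L; [cbn; rewrite hd_cons; exact Ht|].
  rewrite <- drop_tl, tl_cons. apply Hw. lia.
Qed.

Lemma semidec_ball S B : semidec (fun p z => S p (fstn z) (sndn z)) -> recursive B ->
  semidec (fun p n => forall x, x < B p n -> S p n x).
Proof.
  intros (G & HG & H) HB.
  exists (fun p z => nat_rect (fun _ => nat) 0 (fun k r => match r with
    | 0 => G p (pr (pr (fstn z) k) (hd (drop k (sndn z)))) | _ => 1 end) (B p (fstn z))).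
  split.
  - apply (recursive_prim (fun _ _ => 0) (fun p z k r => match r with
      | 0 => G p (pr (pr (fstn z) k) (hd (drop k (sndn z)))) | _ => 1 end)).
    + apply recursive_const.
    + apply recursive_case; [|apply (recursive_comp G); trivial|apply recursive_const];
      repeat first [apply recursive_hd | apply recursive_pr | apply recursive_fstn
        | apply recursive_sndn |
        apply recursive_drop | apply recursive_id].
    + apply recursive_comp; trivial. apply recursive_fstn, recursive_id.
  - intros p n.
    assert (E : forall w b, nat_rect (fun _ => nat) 0 (fun k r => match r with
      | 0 => G p (pr (pr n k) (hd (drop k w))) | _ => 1 end) b = 0 <->
      forall x, x < b -> G p (pr (pr n x) (hd (drop x w))) = 0).
    { intros w b. induction b as [|b IHb]; cbn; [split; trivial; intros; lia|].
      destruct nat_rect eqn:E.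
      - split.
        + intros Hb x L. destruct (Nat.eq_dec x b) as [-> |]; trivial.
          apply IHb; trivial. lia.
        + intros Hx. apply Hx. lia.
      - split; [discriminate|]. intros Hx.
        discriminate (proj2 IHb (fun x L => Hx x (Nat.lt_lt_succ_r _ _ L))). }
    split.
    + intros Hx. destruct (bounded_choice_list (B p n) (fun x t => G p (pr (pr n x) t) = 0))
        as [w Hw].
      * intros x L. specialize (H p (pr n x)). prs. apply H, Hx, L.
      * exists w. prs. apply E, Hw.
    + intros [w Hw] x L. prs. rewrite E in Hw. specialize (H p (pr n x)). prs.
      apply H. eauto.
Qed.

Ltac semidec_step := cbn beta; first
  [ eassumption
  | apply recursive_hd | apply recursive_tl | apply recursive_cons | apply recursive_drop
  | apply recursive_id | apply recursive_const | apply recursive_pr | apply recursive_fstn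
  | apply recursive_sndn
  | apply recursive_S | apply recursive_pred | apply recursive_dbl | apply recursive_oracle
  | apply recursive_prefix
  | apply semidec_and | apply semidec_or | apply semidec_ex | apply semidec_ball
  | apply semidec_eq_nat
  | apply semidec_neq_nat | apply semidec_lt | apply semidec_le
  | match goal with
    | H : recursive ?F |- _ => apply (recursive_comp F _ H)
    | H : semidec ?S |- _ => apply (semidec_comp S _ H)
    end ].
Ltac semidec_auto := repeat semidec_step.

Lemma semidec_els F G : recursive F -> recursive G -> semidec (fun p n => els (F p n) (G p n)).
Proof. intros HF HG. unfold els. semidec_auto. Qed.

(** * Semidecidability of evaluation with a partial oracle *)

Lemma decode_fuel_enough n : forall k, n < k -> decode_fuel k n = decode n.
Proof.
  unfold decode. induction n as [n IH] using lt_wf_ind. intros [|k] L; [lia|].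
  cbn [decode_fuel].
  destruct (of_nat n) as [t a] eqn:En. destruct (of_nat a) as [a1 a2] eqn:Ea.
  pose proof (cancel_to_of n) as Hn. rewrite En in Hn.
  pose proof (cancel_to_of a) as Ha. rewrite Ea in Ha.
  pose proof (to_nat_non_decreasing t a) as Ln. rewrite Hn in Ln.
  pose proof (to_nat_non_decreasing a1 a2) as La. rewrite Ha in La.
  (* Tags 0 to 4 are the constructors without arguments. Any other tag is at least 5, which makes
     the argument codes strictly smaller than [n]. *)
  do 5 (destruct t as [|t]; [reflexivity|]).
  rewrite (IH a1), (IH a1 ltac:(lia) n), (IH a2), (IH a2 ltac:(lia) n) by lia.
  rewrite (IH a), (IH a ltac:(lia) n) by lia. reflexivity.
Qed.

Lemma decode_eq e : decode e =
  let a := sndn e in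
  match fstn e with
  | 0 => Zero | 1 => Succ | 2 => Left | 3 => Right | 4 => Oracle
  | 5 => Pair (decode (fstn a)) (decode (sndn a))
  | 6 => Comp (decode (fstn a)) (decode (sndn a))
  | 7 => Prec (decode (fstn a)) (decode (sndn a))
  | _ => Rfind (decode a)
  end.
Proof.
  assert (H : forall k, decode_fuel (S k) e =
    let a := sndn e in
    match fstn e with
    | 0 => Zero | 1 => Succ | 2 => Left | 3 => Right | 4 => Oracle
    | 5 => Pair (decode_fuel k (fstn a)) (decode_fuel k (sndn a))
    | 6 => Comp (decode_fuel k (fstn a)) (decode_fuel k (sndn a))
    | 7 => Prec (decode_fuel k (fstn a)) (decode_fuel k (sndn a))
    | _ => Rfind (decode_fuel k a)
    end).
  { intros k. cbn [decode_fuel]. unfold fstn, sndn.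
    destruct (of_nat e) as [t a]. cbn [fst snd].
    destruct (of_nat a). reflexivity. }
  unfold decode at 1. rewrite H. cbn zeta.
  pose proof (to_nat_non_decreasing (fstn e) (sndn e)) as L1.
  pose proof (to_nat_non_decreasing (fstn (sndn e)) (sndn (sndn e))) as L2.
  rewrite !pr_fstn_sndn in L1, L2.
  destruct (fstn e) as [|[|[|[|[|t]]]]]; trivial.
  rewrite !decode_fuel_enough by lia. reflexivity.
Qed.

Definition fact (e n m : nat) : nat := pr e (pr n m).

(* One evaluation step of the machine number [e] on [n] with value [m]: [O] is the
   graph of a partial oracle, and [M] holds the facts already established. *)
Definition rule (O : nat -> nat -> Prop) (e n m : nat) (M : nat -> Prop) : Prop :=
  (fstn e = 0 /\ m = 0) \/
  (fstn e = 1 /\ m = S n) \/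
  (fstn e = 2 /\ m = fstn n) \/
  (fstn e = 3 /\ m = sndn n) \/
  (fstn e = 4 /\ O n m) \/
  (fstn e = 5 /\ M (fact (fstn (sndn e)) n (fstn m)) /\
     M (fact (sndn (sndn e)) n (sndn m))) \/
  (fstn e = 6 /\ exists k, M (fact (sndn (sndn e)) n k) /\
     M (fact (fstn (sndn e)) k m)) \/
  (fstn e = 7 /\ sndn n = 0 /\ M (fact (fstn (sndn e)) (fstn n) m)) \/
  (fstn e = 7 /\ exists k, sndn n = S k /\ exists r, M (fact e (pr (fstn n) k) r) /\
     M (fact (sndn (sndn e)) (pr (fstn n) (pr k r)) m)) \/
  (7 < fstn e /\ M (fact (sndn e) (pr n m) 0) /\
     forall k, k < m -> exists v, M (fact (sndn e) (pr n k) (S v))).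

(** The least fixed point of [rule]. Premises form a finite coded list, not an arbitrary set, so
    that derivations use finitely much of the oracle and can be coded by numbers. *)
Inductive derives (O : nat -> nat -> Prop) (x : nat) : Prop :=
| derives_intro l :
    rule O (fstn x) (fstn (sndn x)) (sndn (sndn x)) (els l) ->
    (forall y, els l y -> derives O y) -> derives O x.

Lemma rule_mono (O O' : nat -> nat -> Prop) e n m (M M' : nat -> Prop) :
  (forall i v, O i v -> O' i v) -> (forall y, M y -> M' y) ->
  rule O e n m M -> rule O' e n m M'.
Proof.
  intros HO HM. unfold rule.
  intros [H|[H|[H|[H|[H|[H|[[H [k Hk]]|[H|[[H (k & E & r & Hr)]|(H & H0 & Hk)]]]]]]]]].
  1-5: intuition auto.
  1: intuition auto.
  1: do 6 right; left; split; trivial; exists k; intuition auto.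
  1: intuition auto.
  1: do 8 right; left; split; trivial; exists k; split; trivial; exists r; intuition auto.
  do 9 right. repeat split; auto. intros k L. destruct (Hk k L) as [v Hv]. eauto.
Qed.

Lemma derives_mono (O O' : nat -> nat -> Prop) : (forall i v, O i v -> O' i v) ->
  forall x, derives O x -> derives O' x.
Proof.
  intros HO. apply derives_ind. intros x l Hr _ IH.
  apply (derives_intro _ _ l); trivial.
  apply (rule_mono O O' _ _ _ (els l)); trivial.
Qed.

Lemma els_common_stage (P : nat -> nat -> Prop) :
  (forall k k' y, k <= k' -> P k y -> P k' y) ->
  forall l, (forall y, els l y -> exists k, P k y) ->
  exists k, forall y, els l y -> P k y.
Proof.
  intros HP l. induction l as [|h t IH] using coded_list_ind; intros H.
  - exists 0. intros y Hy. destruct (els_nil _ Hy).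
  - destruct IH as [k Hk]; [intros y Hy; apply H, els_cons; auto|].
    destruct h as [|z].
    + exists k. intros y [E|Hy]%els_cons; [discriminate|auto].
    + destruct (H z) as [k' Hk']; [apply els_cons; auto|].
      exists (k + k'). intros y [[= <-] | Hy]%els_cons.
      * apply (HP k'); trivial. lia.
      * apply (HP k); auto. lia.
Qed.

(** A derivation asks the oracle finitely often, and by monotonicity one stage answers all its
    queries. *)
Lemma derives_compact (O : nat -> nat -> nat -> Prop) :
  (forall k k' i v, k <= k' -> O k i v -> O k' i v) ->
  forall x, derives (fun i v => exists k, O k i v) x -> exists k, derives (O k) x.
Proof.
  intros HO. apply derives_ind. intros x l Hr _ IH.
  assert (mono : forall k k' y, k <= k' -> derives (O k) y -> derives (O k') y).
  { intros k k' y L. apply derives_mono. intros i v. apply HO, L. }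
  destruct (els_common_stage _ mono l IH) as [k Hk].
  assert (exists k', k <= k' /\
    rule (O k') (fstn x) (fstn (sndn x)) (sndn (sndn x)) (els l)) as (k' & L & H').
  { unfold rule in Hr |- *.
    (* Only tag 4 consults the oracle; its stage is added to the common stage of the premises. *)
    destruct (Nat.eq_dec (fstn (fstn x)) 4) as [E | N].
    - rewrite E in Hr |- *.
      destruct Hr as [H|[H|[H|[H|[(_ & k0 & H)|H]]]]]; try (exfalso; lia).
      exists (k + k0). split; [lia|]. do 4 right. left. split; trivial.
      apply (HO k0); trivial. lia.
    - exists k. split; trivial. tauto. }
  exists k'. apply (derives_intro _ _ l); eauto.
Qed.

(** Soundness: [O] may be any part of the graph of [p], so what a finite oracle derives holds for
    every total oracle extending it. *)
Lemma derives_eval (O : nat -> nat -> Prop) p : (forall i v, O i v -> v = p i) ->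
  forall x, derives O x -> eval p (decode (fstn x)) (fstn (sndn x)) (sndn (sndn x)).
Proof.
  intros HO. apply derives_ind. intros x l Hr _ IH.
  assert (IH' : forall e n m, els l (fact e n m) -> eval p (decode e) n m).
  { intros e n m H. apply IH in H. unfold fact in H. prs. exact H. }
  clear IH. revert Hr. generalize (fstn x) (fstn (sndn x)) (sndn (sndn x)).
  intros e n m Hr. rewrite decode_eq. unfold rule in Hr.
  destruct Hr as [[E H]|[[E H]|[[E H]|[[E H]|[[E H]|[(E & H1 & H2)|[[E [k [H1 H2]]]|[(E & E0 & H)|
    [(E & k & Ek & r & H1 & H2)|(E & H0 & Hk)]]]]]]]]].
  1-9: rewrite E.
  - exact H.
  - exact H.
  - exact H.
  - exact H.
  - exact (HO _ _ H).
  - exists (fstn m), (sndn m). prs. auto.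
  - exists k. auto.
  - cbn. fold (fstn n) (sndn n). rewrite E0. cbn. auto.
  (* The first premise concerns the same machine [e] at a smaller recursion depth, so it has to be
     unfolded once more. *)
  - apply IH' in H1. rewrite decode_eq, E in H1. cbn in H1.
    fold (fstn (pr (fstn n) k)) (sndn (pr (fstn n) k)) in H1. prs.
    cbn. fold (fstn n) (sndn n). rewrite Ek. cbn. exists r. split; auto.
  - assert (G : eval p (Rfind (decode (sndn e))) n m).
    { split; [auto|]. intros k L. destruct (Hk k L) as [v Hv]. eauto. }
    destruct (fstn e) as [|[|[|[|[|[|[|[|t]]]]]]]] eqn:Et; trivial; lia.
Qed.

Lemma els_collect (P : nat -> Prop) (Q : nat -> nat -> Prop) m :
  (forall k, k < m -> exists y, P y /\ Q k y) ->
  exists l, (forall y, els l y -> P y) /\ forall k, k < m -> exists y, els l y /\ Q k y.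
Proof.
  induction m as [|m IH]; intros H.
  - exists 0. split; [intros y Hy; destruct (els_nil _ Hy) | intros; lia].
  - destruct IH as (l & Hl & Hk); [auto|]. destruct (H m) as (z & Hz & Hmz); [lia|].
    exists (cons (S z) l). split.
    + intros y [[= <-]|Hy]%els_cons; auto.
    + intros k L. destruct (Nat.eq_dec k m) as [->|N].
      * exists z. rewrite els_cons. auto.
      * destruct (Hk k) as (y & Hy & Hky); [lia|]. exists y. rewrite els_cons. auto.
Qed.

Lemma derives_rule (O : nat -> nat -> Prop) e n m l :
  rule O e n m (els l) -> (forall y, els l y -> derives O y) -> derives O (fact e n m).
Proof.
  intros Hr Hl. apply (derives_intro _ _ l); trivial. unfold fact. prs. exact Hr.
Qed.

(** Completeness, for every number that decodes to [c]: [decode] is not injective, and the universal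
    machine receives arbitrary numbers. *)
Lemma eval_derives (O : nat -> nat -> Prop) p : (forall i, O i (p i)) ->
  forall c e n m, decode e = c -> eval p c n m -> derives O (fact e n m).
Proof.
  intros HO.
  assert (two : forall a b, derives O a -> derives O b ->
    forall y, els (cons (S a) (cons (S b) 0)) y -> derives O y).
  { intros a b Ha Hb y. rewrite !els_cons.
    intros [[= <-]|[[= <-]|H]]; trivial. destruct (els_nil _ H). }
  assert (e1 : forall a b, els (cons (S a) (cons (S b) 0)) a)
    by (intros; apply els_cons; auto).
  assert (e2 : forall a b, els (cons (S a) (cons (S b) 0)) b)
    by (intros; rewrite !els_cons; auto).
  assert (nil : forall y, els 0 y -> derives O y)
    by (intros y H; destruct (els_nil _ H)).
  induction c; intros e n m Ee H; rewrite decode_eq in Ee; cbn zeta in Ee;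
    destruct (fstn e) as [|[|[|[|[|[|[|[|t]]]]]]]] eqn:Et; try discriminate Ee.
  - apply (derives_rule _ _ _ _ 0); trivial. left. auto.
  - apply (derives_rule _ _ _ _ 0); trivial. do 1 right. left. auto.
  - apply (derives_rule _ _ _ _ 0); trivial. do 2 right. left. auto.
  - apply (derives_rule _ _ _ _ 0); trivial. do 3 right. left. auto.
  - apply (derives_rule _ _ _ _ 0); trivial. do 4 right. left. split; trivial.
    cbn in H. subst m. apply HO.
  - injection Ee as E1 E2. destruct H as (a & b & Ha & Hb & ->).
    eapply derives_rule; [|apply two; [apply (IHc1 _ _ _ E1 Ha) | apply (IHc2 _ _ _ E2 Hb)]].
    do 5 right. left. prs. auto.
  - injection Ee as E1 E2. destruct H as (k & Hk & H).
    eapply derives_rule; [|apply two; [apply (IHc1 _ _ _ E1 H) | apply (IHc2 _ _ _ E2 Hk)]].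
    do 6 right. left. split; trivial. exists k. auto.
  - injection Ee as E1 E2. cbn in H. fold (fstn n) (sndn n) in H.
    (* Primitive recursion refers back to [e] itself, hence an inner induction on its depth. *)
    remember (sndn n) as j eqn:Ej. revert n m H Ej.
    induction j as [|j IHj]; cbn; intros n m H Ej.
    + eapply derives_rule; [|apply two; apply (IHc1 _ _ _ E1 H)].
      do 7 right. left. auto.
    + destruct H as (r & Hr & H).
      eapply derives_rule; [|apply two;
        [apply (IHj (pr (fstn n) j) r) | apply (IHc2 _ _ _ E2 H)]].
      * do 8 right. left. split; trivial. exists j. split; [congruence|].
        exists r. auto.
      * prs. exact Hr.
      * prs. reflexivity.
  - injection Ee as E1. destruct H as [H0 Hk].
    (* A search has one premise for each value tried before [m]; these are gathered into a list. *)
    destruct (els_collect (derives O) (fun k y => exists v, y = fact (sndn e) (pr n k) (S v)) m)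
      as (l & Hl & Hlk).
    { intros k L. destruct (Hk k L) as [v Hv]. eauto. }
    apply (derives_rule _ _ _ _ (cons (S (fact (sndn e) (pr n m) 0)) l)).
    + do 9 right. split; [lia|]. split; [apply els_cons; auto|].
      intros k L. destruct (Hlk k L) as (y & Hy & v & ->). exists v. apply els_cons. auto.
    + intros y [[= <-]|Hy]%els_cons; auto.
Qed.

(** A derivation written as a list in which each entry follows by [rule] from the entries after it.
    Positions past the end read as 0, an empty entry, so the bound [C] is harmless. *)
Definition certificate (O : nat -> nat -> Prop) (C : nat) : Prop :=
  forall j, j < C -> hd (drop j C) = 0 \/ exists x, hd (drop j C) = S x /\
    rule O (fstn x) (fstn (sndn x)) (sndn (sndn x)) (els (tl (drop j C))).

Lemma certificate_nil O : certificate O 0.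
Proof. intros j L. lia. Qed.

Lemma certificate_cons O h t : certificate O (cons h t) <->
  certificate O t /\ (h = 0 \/ exists x, h = S x /\
    rule O (fstn x) (fstn (sndn x)) (sndn (sndn x)) (els t)).
Proof.
  pose proof (tl_lt h t) as Lt. split.
  - intros H. split.
    + intros j L. specialize (H (S j) ltac:(lia)).
      rewrite <- drop_tl, tl_cons in H. exact H.
    + specialize (H 0 ltac:(lia)). cbn in H. rewrite hd_cons, tl_cons in H. exact H.
  - intros [H H0] [|j] L.
    + cbn. rewrite hd_cons, tl_cons. exact H0.
    + rewrite <- drop_tl, tl_cons. destruct (Nat.lt_ge_cases j t) as [L'|L']; auto.
      left. rewrite drop_ge by trivial. reflexivity.
Qed.

Lemma certificate_sound O C : certificate O C -> forall x, els C x -> derives O x.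
Proof.
  induction C as [|h t IH] using coded_list_ind; intros H x Hx; [destruct (els_nil _ Hx)|].
  apply certificate_cons in H as [H H0]. apply els_cons in Hx as [->|Hx]; auto.
  destruct H0 as [|(y & [= <-] & H0)]; [discriminate|].
  apply (derives_intro _ _ t); auto.
Qed.

(** Concatenation works because more available facts never invalidate a rule. *)
Lemma certificate_merge O C1 C2 : certificate O C1 -> certificate O C2 ->
  exists C, certificate O C /\ forall x, els C1 x \/ els C2 x -> els C x.
Proof.
  intros H1 H2. induction C1 as [|h t IH] using coded_list_ind.
  - exists C2. split; trivial. intros x [H|H]; trivial. destruct (els_nil _ H).
  - apply certificate_cons in H1 as [H1 H0]. destruct (IH H1) as (C & HC & HE).
    exists (cons h C). split.
    + apply certificate_cons. split; trivial.
      destruct H0 as [H0|(x & -> & H0)]; [auto|]. right. exists x. split; trivial.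
      revert H0. apply rule_mono; auto.
    + intros x. rewrite !els_cons. intros [[H|H]|H]; auto.
Qed.

Lemma certificate_complete O x : derives O x -> exists C, certificate O C /\ els C x.
Proof.
  revert x. apply derives_ind. intros x l Hr _ IH.
  assert (exists C, certificate O C /\ forall y, els l y -> els C y) as (C & HC & HE).
  { clear Hr. induction l as [|h t IHl] using coded_list_ind.
    - exists 0. split; [apply certificate_nil|]. auto.
    - destruct IHl as (C & HC & HE); [intros y Hy; apply IH, els_cons; auto|].
      destruct h as [|z].
      + exists C. split; trivial. intros y [E|Hy]%els_cons; [discriminate|auto].
      + destruct (IH z) as (C' & HC' & Hz); [apply els_cons; auto|].
        destruct (certificate_merge O C' C HC' HC) as (C'' & H & H').
        exists C''. split; trivial. intros y [[= <-]|Hy]%els_cons; auto. }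
  exists (cons (S x) C). split.
  - apply certificate_cons. split; trivial. right. exists x. split; trivial.
    revert Hr. apply rule_mono; auto.
  - apply els_cons. auto.
Qed.

(** Derivability is a search for a certificate, and checking one needs only bounded universal
    quantifiers and further searches. The oracle relation may vary with the argument [n]. *)
Lemma semidec_derives (O : baire -> nat -> nat -> nat -> Prop) X :
  semidec (fun p z => O p (fstn z) (fstn (sndn z)) (sndn (sndn z))) -> recursive X ->
  semidec (fun p n => derives (O p n) (X p n)).
Proof.
  intros HO HX.
  apply (semidec_ext (fun p n => exists C, certificate (O p n) C /\ els C (X p n))).
  - unfold certificate, rule, fact.
    assert (HO' : forall A I V, recursive A -> recursive I -> recursive V ->
      semidec (fun p n => O p (A p n) (I p n) (V p n))).
    { intros A I V HA HI HV.
      apply (semidec_ext _ _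
        (semidec_comp _ _ HO (recursive_pr _ _ HA (recursive_pr _ _ HI HV)))).
      intros p n. prs. reflexivity. }
    repeat first [apply HO' | apply semidec_els | semidec_step].
  - intros p n. split.
    + apply certificate_complete.
    + intros (C & HC & HE). exact (certificate_sound _ _ HC _ HE).
Qed.

Definition semidec_rel (O : baire -> nat -> nat -> nat -> Prop) : Prop :=
  semidec (fun p z => O p (fstn z) (fstn (sndn z)) (sndn (sndn z))).

Lemma semidec_rel_app O A I V : semidec_rel O -> recursive A -> recursive I -> recursive V ->
  semidec (fun p n => O p (A p n) (I p n) (V p n)).
Proof.
  intros HO HA HI HV.
  apply (semidec_ext _ _ (semidec_comp _ _ HO (recursive_pr _ _ HA (recursive_pr _ _ HI HV)))).
  intros p n. prs. reflexivity.
Qed.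

(** * Accepting runs on partial and finite oracles *)

Definition graph (p : baire) : nat -> nat -> Prop := fun i v => v = p i.

Definition ran (p : baire) (y : nat) : Prop := exists k, p k = S y.

(* The graph of the finite sequence coded by [s]; codes list the entries backwards,
   so that the index of an entry is the length of the list after it. *)
Definition entry (s i v : nat) : Prop :=
  exists j r, drop j s = cons v r /\ drop i r = 0 /\ forall i', i' < i -> drop i' r <> 0.

Lemma entry_prefix p k i v : entry (prefix p k) i v <-> i < k /\ v = p i.
Proof.
  unfold entry. split.
  - intros (j & r & H & H0 & Hi). rewrite drop_prefix in H.
    destruct (k - j) as [|l] eqn:E; [discriminate|]. rewrite prefix_S in H.
    assert (r = prefix p l) as ->
      by (rewrite <- (tl_cons v r), <- H; apply tl_cons).
    assert (v = p l) as ->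
      by (rewrite <- (hd_cons v (prefix p l)), <- H; apply hd_cons).
    rewrite drop_prefix in H0.
    destruct (l - i) as [|d] eqn:E'; [|discriminate].
    assert (i = l) as ->; [|split; trivial; lia].
    destruct (Nat.lt_trichotomy i l) as [L | [L | L]]; trivial; [lia|].
    exfalso. apply (Hi l L). rewrite drop_prefix, Nat.sub_diag. reflexivity.
  - intros [L ->]. exists (k - S i), (prefix p i). rewrite drop_prefix.
    replace (k - (k - S i)) with (S i) by lia. split; [apply prefix_S|].
    rewrite drop_prefix, Nat.sub_diag. split; trivial.
    intros i' L'. rewrite drop_prefix.
    destruct (i - i') eqn:E; [lia|]. discriminate.
Qed.

(** The relational form of the oracle in [univ]: [Q] is read from index 1 on, since index 0 holds
    the machine number. *)
Definition oracle_join (Q A : nat -> nat -> Prop) (i v : nat) : Prop :=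
  (exists j, i = 2 * j /\ Q (S j) v) \/ (exists j, i = S (2 * j) /\ A j v).

(* The machine named by the function with graph [Q] answers something nonzero when
   it is run on the partial oracle [A]. *)
Definition accept (Q A : nat -> nat -> Prop) : Prop :=
  exists e n v, Q 0 e /\ derives (oracle_join Q A) (fact e n (S v)).

Lemma semidec_entry I J V : recursive I -> recursive J -> recursive V ->
  semidec (fun p n => entry (I p n) (J p n) (V p n)).
Proof. intros HI HJ HV. unfold entry. semidec_auto. Qed.

Lemma semidec_ran F : recursive F -> semidec (fun p n => ran p (F p n)).
Proof. intros H. unfold ran. semidec_auto. Qed.

Ltac semidec_rel_step := first
  [ semidec_step
  | apply semidec_entry | apply semidec_els | apply semidec_ran
  | match goal with
    | H : semidec_rel ?O |- _ => apply (semidec_rel_app O _ _ _ H)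
    end
  | unfold semidec_rel, fact, graph, oracle_join; apply semidec_derives ].

Lemma semidec_accept Q A : semidec_rel Q -> semidec_rel A ->
  semidec (fun p n => accept (Q p n) (A p n)).
Proof.
  intros HQ HA. unfold accept, fact.
  assert (forall F, recursive F ->
    semidec_rel (fun p n => oracle_join (Q p (F p n)) (A p (F p n)))) as HJ.
  { intros F HF. unfold semidec_rel, oracle_join. repeat semidec_rel_step. }
  repeat first [semidec_rel_step | apply semidec_derives].
  all: apply HJ; semidec_auto.
Qed.

Section Acceptance.
Variables (Z : repspace) (q : baire) (U : opens Z) (z : baire) (x : Z).
Hypotheses (HU : delta (opens Z) q U) (Hz : delta Z z x).

Lemma accept_sound A : (forall i v, A i v -> v = z i) -> accept (graph q) A -> set_of U x.
Proof.
  intros HA (e & n & v & -> & H). destruct (HU z x Hz) as (r & Hr & Hx). cbn in Hx.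
  apply NNPP. intros N. apply Hx in N.
  assert (E : S v = r n); [|rewrite N in E; discriminate].
  apply (eval_fun (join (fun k => q (S k)) z) (decode (q 0)) n); [|apply Hr].
  apply (derives_eval _ (join (fun k => q (S k)) z)) in H.
  - unfold fact in H. prs. exact H.
  - intros i w [(j & -> & E)|(j & -> & E)].
    + rewrite join_even. exact E.
    + rewrite join_odd. auto.
Qed.

Lemma accept_complete A : (forall i, A i (z i)) -> set_of U x -> accept (graph q) A.
Proof.
  intros HA Ux. destruct (HU z x Hz) as (r & Hr & Hx). cbn in Hx.
  assert (exists n, r n <> 0) as [n Hn].
  { apply not_all_not_ex. intros N. apply Hx; trivial.
    apply functional_extensionality. intros n. apply NNPP, N. }
  exists (q 0), n, (pred (r n)). split; [reflexivity|].
  apply (eval_derives _ (join (fun k => q (S k)) z)) with (c := decode (q 0)); trivial.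
  - intros i. destruct (Nat.Even_or_Odd i) as [[j ->]|[j ->]].
    + left. exists j. rewrite join_even. split; reflexivity.
    + right. exists j. rewrite Nat.add_1_r, join_odd. auto.
  - replace (S (pred (r n))) with (r n) by lia. apply Hr.
Qed.

Lemma accept_iff : set_of U x <-> accept (graph q) (graph z).
Proof.
  split; [apply accept_complete | apply accept_sound]; unfold graph; auto.
Qed.

(** By compactness an accepting run reads a finite part of [z]; conversely, soundness holds for any
    part of its graph. *)
Lemma accept_finite : set_of U x <-> exists k, accept (graph q) (entry (prefix z k)).
Proof.
  split.
  - intros Ux.
    (* The graph of [z] is presented as the increasing union of its finite restrictions, the form
       that compactness expects. *)
    destruct (accept_complete (fun i v => exists k, i < k /\ v = z i)) as (e & n & v & He & H);
      trivial.
    { intros i. exists (S i). auto. }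
    pose (O k := oracle_join (graph q) (fun i v => i < k /\ v = z i)).
    destruct (derives_compact O) with (x := fact e n (S v)) as [k Hk].
    + intros k k' i w L [H'|(j & -> & L' & E)]; [left; exact H'|].
      right. exists j. repeat split; trivial. lia.
    + revert H. apply derives_mono. intros i w [H'|(j & -> & k & L & E)].
      * exists 0. left. exact H'.
      * exists k. right. exists j. auto.
    + exists k, e, n, v. split; trivial. revert Hk. apply derives_mono.
      intros i w [H'|(j & -> & L & E)]; [left; exact H'|].
      right. exists j. split; trivial. apply entry_prefix. auto.
  - intros [k Hk]. apply (accept_sound (entry (prefix z k))); trivial.
    intros i v H. apply entry_prefix in H. tauto.
Qed.

End Acceptance.

(** [H s n] says that the program deciding the stages of [S] reports success when run with the
    finite sequence [s] as partial oracle. Thus semidecidable properties are effectively open. *)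
Lemma finite_use S : semidec S -> exists H : nat -> nat -> Prop,
  semidec (fun _ z => H (fstn z) (sndn z)) /\
  (forall p n, S p n <-> exists k, H (prefix p k) n) /\
  (forall p k k' n, k <= k' -> H (prefix p k) n -> H (prefix p k') n).
Proof.
  intros (G & [c Hc] & HS).
  exists (fun s n => exists t, derives (entry s) (fact (encode c) (pr n t) 0)).
  split; [|split].
  - unfold fact. repeat first [semidec_rel_step | apply semidec_derives].
  - intros p n. rewrite HS. split.
    + intros [t Ht].
      destruct (derives_compact (fun k i v => i < k /\ v = p i)) with
        (x := fact (encode c) (pr n t) 0) as [k Hk].
      * intros k k' i v L [L' E]. split; trivial. lia.
      * apply (eval_derives _ p) with (c := c).
        -- intros i. exists (Datatypes.S i). auto.
        -- apply decode_encode.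
        -- rewrite <- Ht. apply Hc.
      * exists k, t. revert Hk. apply derives_mono. intros i v. apply entry_prefix.
    + intros (k & t & H). exists t.
      apply (derives_eval _ p) in H.
      * unfold fact in H. prs. rewrite decode_encode in H.
        apply (eval_fun p c (pr n t)); trivial.
      * intros i v E. apply entry_prefix in E. tauto.
  - intros p k k' n L [t H]. exists t. revert H. apply derives_mono.
    intros i v. rewrite !entry_prefix. intros [L' E]. split; trivial. lia.
Qed.

(** * Computability of maps *)

(** A realizer can be enlarged to the full partial function computed by its program, so only the
    program matters. *)
Lemma computable_mv_code (X Y : repspace) (f : X -> Y -> Prop) : computable_mv f <->
  exists c, forall p x, delta X p x -> (exists y, f x y) ->
    exists q y, (forall n, eval p c n (q n)) /\ delta Y q y /\ f x y.
Proof.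
  split.
  - intros (F & [c Hc] & HF & HR). exists c. intros p x Hp Hx.
    destruct (HR p x Hp Hx) as (q & y & Hq & H). exists q, y. eauto.
  - intros [c Hc]. exists (fun p q => forall n, eval p c n (q n)).
    split; [exists c; auto|]. split; [|exact Hc].
    intros p q q' H H'. apply functional_extensionality. intros n.
    exact (eval_fun _ _ _ _ _ (H n) (H' n)).
Qed.

Lemma computable_code (X Y : repspace) (f : X -> Y) : computable f <->
  exists c, forall p x, delta X p x ->
    exists q, (forall n, eval p c n (q n)) /\ delta Y q (f x).
Proof.
  unfold computable. rewrite computable_mv_code. split; intros [c Hc]; exists c.
  - intros p x Hp. destruct (Hc p x Hp) as (q & y & Hq & Hy & ->); eauto.
  - intros p x Hp _. destruct (Hc p x Hp) as (q & Hq & Hy). eauto.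
Qed.

Lemma computable_of_recursive (X Y : repspace) (f : X -> Y) F : recursive F ->
  (forall p x, delta X p x -> delta Y (F p) (f x)) -> computable f.
Proof.
  intros [c Hc] H. apply computable_code. exists c. intros p x Hp. exists (F p). auto.
Qed.

Lemma computable_mv_comp (X Y Z : repspace) (f : X -> Y) (g : Y -> Z -> Prop) :
  computable f -> computable_mv g -> computable_mv (fun x z => g (f x) z).
Proof.
  rewrite computable_code, !computable_mv_code. intros [c Hc] [d Hd].
  exists (subst d c). intros p x Hp Hx.
  destruct (Hc p x Hp) as (q & Hq & Hy). destruct (Hd q (f x) Hy Hx) as (r & z & Hr & H).
  exists r, z. split; trivial. intros n. apply (eval_subst p q); auto.
Qed.

Lemma computable_comp (X Y Z : repspace) (f : X -> Y) (g : Y -> Z) :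
  computable f -> computable g -> computable (fun x => g (f x)).
Proof. apply computable_mv_comp. Qed.

Lemma isomorphic_trans (X Y Z : repspace) :
  isomorphic X Y -> isomorphic Y Z -> isomorphic X Z.
Proof.
  intros (f & Hf & f' & Hf' & E1 & E2) (g & Hg & g' & Hg' & E3 & E4).
  exists (fun x => g (f x)). split; [apply (computable_comp _ Y); trivial|].
  exists (fun z => f' (g' z)). split; [apply (computable_comp _ Y); trivial|].
  split; intros; congruence.
Qed.

(** The format of a name in a function space: a machine number followed by a parameter. *)
Definition opname (e : nat) (p : baire) : baire :=
  fun i => match i with 0 => e | S k => p k end.

Lemma recursive_opname e F : recursive F -> recursive (fun p n => opname e p (F p n)).
Proof.
  intros H. apply (recursive_case F (fun _ _ => e) (fun p _ k => p k)); trivial.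
  - apply recursive_const.
  - apply recursive_oracle, recursive_sndn, recursive_id.
Qed.

(** The machine outputs 1 at the stages where [S] is confirmed and 0 elsewhere, hence a name of
    bottom exactly when [S] fails. The number [e] is independent of the parameter and of the
    space. *)
Lemma semidec_opens_name S : semidec S -> exists e, forall p (Z : repspace) (U : opens Z),
  (forall z x, delta Z z x -> (set_of U x <-> S (join p z) 0)) ->
  delta (opens Z) (opname e p) U.
Proof.
  intros (G & HG & HS).
  assert (HG' : recursive (fun p t => match G p (pr 0 t) with 0 => 1 | _ => 0 end)).
  { apply recursive_case; semidec_auto. }
  destruct HG' as [c Hc]. exists (encode c). intros p Z U HU z x Hz.
  exists (fun t => match G (join p z) (pr 0 t) with 0 => 1 | _ => 0 end). split.
  - intros n. cbn [opname]. rewrite decode_encode. apply Hc.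
  - cbn. fold (set_of U). rewrite (HU z x Hz), HS. split.
    + intros N. apply functional_extensionality. intros t.
      destruct (G (join p z) (pr 0 t)) eqn:E; trivial. exfalso. eauto.
    + intros E [t Ht]. apply (f_equal (fun r => r t)) in E. rewrite Ht in E. discriminate.
Qed.

Lemma semidec_is_open (Z : repspace) (U : Z -> Prop) S : semidec S ->
  (forall z x, delta Z z x -> (U x <-> S z 0)) -> is_open Z U.
Proof.
  intros (G & [c Hc] & HS) HU z x Hz Ux. apply (HU z x Hz), HS in Ux as [t Ht].
  destruct (eval_use z c _ _ (Hc z (pr 0 t))) as [n Hn].
  exists n. intros z' x' Hz' A. apply (HU z' x' Hz'), HS. exists t.
  exact (eq_trans (eval_fun _ _ _ _ _ (Hc _ _) (Hn z' A)) Ht).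
Qed.

Definition left_half (p : baire) : baire := fun k => p (2 * k).
Definition right_half (p : baire) : baire := fun k => p (S (2 * k)).

Lemma left_half_join p q : left_half (join p q) = p.
Proof. apply functional_extensionality, join_even. Qed.

Lemma right_half_join p q : right_half (join p q) = q.
Proof. apply functional_extensionality, join_odd. Qed.

Lemma recursive_right_half : recursive right_half.
Proof. apply recursive_oracle, recursive_S, recursive_dbl, recursive_id. Qed.

(* [V n] has the name [opname e (fun _ => n)], which is recursive in [n]. *)
Lemma semidec_hits B : semidec B -> exists T, semidec T /\
  forall (Z : repspace) (V : nat -> opens Z),
    (forall z x n, delta Z z x -> (set_of (V n) x <-> B z n)) ->
    forall Q UU, delta (opens (opens Z)) Q UU -> forall n, set_of UU (V n) <-> T Q n.
Proof.
  intros HB.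
  destruct (semidec_opens_name (fun p _ => B (right_half p) (left_half p 0))) as [e He].
  { apply (semidec_ext (fun p n => (fun p n => B (right_half p) n) p (left_half p 0)));
      [|reflexivity].
    apply (semidec_comp (fun p n => B (right_half p) n)).
    - apply (semidec_subst B _ HB recursive_right_half).
    - unfold left_half. semidec_auto. }
  exists (fun Q n => accept (graph Q) (graph (opname e (fun _ => n)))). split.
  - apply semidec_accept; unfold semidec_rel, graph; [semidec_auto|].
    apply semidec_eq_nat; [semidec_auto|].
    apply (recursive_case (fun p z => fstn (sndn z)) (fun _ _ => e) (fun p z k => fstn z));
      semidec_auto.
  - intros Z V HV Q UU HQ n. apply (accept_iff _ _ _ _ _ HQ), He.
    intros z x Hz. rewrite right_half_join, left_half_join. apply HV, Hz.
Qed.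

Lemma delta_opens_nat p A : delta opens_nat p A <-> A = ran p.
Proof.
  cbn. unfold ran. split.
  - intros H. apply functional_extensionality. intros n.
    apply propositional_extensionality, H.
  - intros -> n. tauto.
Qed.

(** Position [pr y t] lists [y] if stage [t] confirms it, and lists nothing otherwise. *)
Lemma semidec_enumeration S : semidec S ->
  exists F, recursive F /\ forall p y, ran (F p) y <-> S p y.
Proof.
  intros (G & HG & HS).
  exists (fun p t => match G p t with 0 => Datatypes.S (fstn t) | _ => 0 end). split.
  - apply recursive_case; semidec_auto.
  - intros p y. rewrite HS. split.
    + intros [t Ht]. exists (sndn t). destruct (G p t) eqn:E; [|discriminate].
      injection Ht as <-. prs. exact E.
    + intros [t Ht]. exists (pr y t). rewrite Ht. prs. reflexivity.
Qed.

Lemma computable_into_sets (X : repspace) P (f : X -> subspace opens_nat P) S : semidec S ->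
  (forall p x, delta X p x -> forall y, proj1_sig (f x) y <-> S p y) -> computable f.
Proof.
  intros HS H. destruct (semidec_enumeration S HS) as (F & HF & HE).
  apply (computable_of_recursive _ _ _ F HF). intros p x Hp.
  change (delta opens_nat (F p) (proj1_sig (f x))).
  apply delta_opens_nat, functional_extensionality. intros y.
  apply propositional_extensionality. rewrite HE. apply H, Hp.
Qed.

Lemma semidec_eval c : semidec (fun p n => eval p c (fstn n) (sndn n)).
Proof.
  apply (semidec_ext (fun p n => derives (graph p) (fact (encode c) (fstn n) (sndn n)))).
  - unfold fact. apply semidec_derives; unfold graph; semidec_auto.
  - intros p n. split.
    + apply eval_derives; [reflexivity | apply decode_encode].
    + intros H. apply (derives_eval _ p) in H; [|trivial].
      unfold fact in H. prs. rewrite decode_encode in H. exact H.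
Qed.

Lemma semidec_ce c : semidec (fun _ n => exists m, eval (fun _ => 0) c n m).
Proof.
  apply semidec_ex.
  exact (semidec_subst _ (fun _ _ => 0) (semidec_eval c) (recursive_const 0)).
Qed.

Lemma ce_of_semidec (A : nat -> Prop) : semidec (fun _ => A) -> ce A.
Proof.
  intros (G & [c Hc] & HA). exists (Rfind c). intros n.
  rewrite (HA (fun _ => 0)). split.
  - intros [t Ht].
    destruct (least_witness (fun t => G (fun _ => 0) (pr n t) = 0) t Ht) as (m & Hm & Hlt).
    exists m. split; [pose proof (Hc (fun _ => 0) (pr n m)) as E; rewrite Hm in E; exact E|].
    intros k L. exists (pred (G (fun _ => 0) (pr n k))).
    specialize (Hlt k L).
    replace (S (pred _)) with (G (fun _ => 0) (pr n k)) by lia. apply Hc.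
  - intros (m & Hm & _). exists m. exact (eval_fun _ _ _ _ _ (Hc _ _) Hm).
Qed.

Lemma semidec_of_computable (X : repspace) P (f : X -> subspace opens_nat P) : computable f ->
  exists S, semidec S /\ forall p x, delta X p x -> forall y, proj1_sig (f x) y <-> S p y.
Proof.
  intros [c Hc]%computable_code.
  exists (fun p y => exists k, eval p c k (S y)). split.
  - apply semidec_ex.
    apply (semidec_ext _ _ (semidec_comp _ (fun p z => pr (sndn z) (S (fstn z)))
      (semidec_eval c) ltac:(semidec_auto))).
    intros p n. prs. reflexivity.
  - intros p x Hp y. destruct (Hc p x Hp) as (q & Hq & H).
    specialize (H y). cbn in H. rewrite H. split; intros [k Hk]; exists k.
    + rewrite <- Hk. apply Hq.
    + exact (eval_fun _ _ _ _ _ (Hq k) Hk).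
Qed.

Ltac semidec_solve := repeat semidec_rel_step.

Lemma delta_sets P p (A : subspace opens_nat P) :
  delta (subspace opens_nat P) p A <-> proj1_sig A = ran p.
Proof. exact (delta_opens_nat p (proj1_sig A)). Qed.

(** * Pi^0_2 sets *)

(** A computable sequence of open subsets of O(N), presented through arbitrary enumerations of the
    argument. *)
Definition semidec_set (K : (nat -> Prop) -> nat -> Prop) : Prop :=
  semidec (fun p => K (ran p)).

Definition semidec_pi02 (P : (nat -> Prop) -> Prop) : Prop :=
  exists K L, semidec_set K /\ semidec_set L /\ forall A, P A <-> forall n, K A n -> L A n.

Lemma semidec_pi02_imp K L : semidec_set K -> semidec_set L ->
  semidec_pi02 (fun A => forall n, K A n -> L A n).
Proof. intros HK HL. exists K, L. split; [|split]; trivial. tauto. Qed.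

(** The first component of the index selects the family of conditions; indices with other tags give
    vacuous implications. *)
Lemma semidec_pi02_and P Q : semidec_pi02 P -> semidec_pi02 Q ->
  semidec_pi02 (fun A => P A /\ Q A).
Proof.
  intros (K & L & HK & HL & E) (K' & L' & HK' & HL' & E'). unfold semidec_set in *.
  exists (fun A n => (fstn n = 0 /\ K A (sndn n)) \/ (fstn n = 1 /\ K' A (sndn n))),
    (fun A n => (fstn n = 0 /\ L A (sndn n)) \/ (fstn n = 1 /\ L' A (sndn n))).
  assert (comb : forall M M', semidec (fun p => M (ran p)) -> semidec (fun p => M' (ran p)) ->
    semidec_set (fun A n => (fstn n = 0 /\ M A (sndn n)) \/ (fstn n = 1 /\ M' A (sndn n)))).
  { intros M M' HM HM'. unfold semidec_set.
    apply semidec_or; apply semidec_and; try (apply semidec_eq_nat; semidec_auto).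
    - apply (semidec_comp (fun p => M (ran p))); semidec_auto.
    - apply (semidec_comp (fun p => M' (ran p))); semidec_auto. }
  split; [|split]; auto. intros A. rewrite E, E'. split.
  - intros [H H'] n [[-> H1]|[-> H1]]; auto.
  - intros H. split; intros n Hn.
    + specialize (H (pr 0 n)). prs. destruct H as [[_ H]|[H _]]; auto. discriminate.
    + specialize (H (pr 1 n)). prs. destruct H as [[H _]|[_ H]]; auto. discriminate.
Qed.

Lemma semidec_set_open K n : semidec_set K -> is_open opens_nat (fun A => K A n).
Proof.
  intros HK. apply (semidec_is_open opens_nat _ (fun p _ => K (ran p) n)).
  - apply (semidec_comp (fun p => K (ran p)) (fun _ _ => n) HK (recursive_const n)).
  - intros p A ->%delta_opens_nat. tauto.
Qed.

Lemma semidec_set_opens K : semidec_set K -> exists U : nat_space -> opens opens_nat,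
  computable U /\ forall n A, set_of (U n) A <-> K A n.
Proof.
  intros HK. exists (fun n => exist _ (fun A => K A n) (semidec_set_open K n HK)).
  split; [|reflexivity].
  destruct (semidec_opens_name (fun p _ => K (ran (right_half p)) (left_half p 0))) as [e He].
  { apply (semidec_comp (fun p => K (ran (right_half p))) (fun p _ => left_half p 0)).
    - apply (semidec_subst _ _ HK recursive_right_half).
    - unfold left_half. semidec_auto. }
  apply (computable_of_recursive nat_space (opens opens_nat) _ (opname e)).
  - apply (recursive_opname e _ recursive_id).
  - intros p n ->. apply He. intros z A ->%delta_opens_nat.
    rewrite right_half_join, left_half_join. reflexivity.
Qed.

Lemma semidec_pi02_pi02 P : semidec_pi02 P -> pi02 opens_nat P.
Proof.
  intros (K & L & HK & HL & E).
  destruct (semidec_set_opens K HK) as (U & HU & EU), (semidec_set_opens L HL) as (V & HV & EV).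
  exists U, V. split; [|split]; trivial. intros A. rewrite E.
  split; intros H n; specialize (H n); rewrite EU, EV in *; exact H.
Qed.

(** The name of [U n] is itself the output of a program, so its graph is semidecidable and can be
    used as part of the oracle of an accepting run. *)
Lemma semidec_of_computable_opens (U : nat_space -> opens baire_space) : computable U ->
  exists S, semidec S /\ forall p n, set_of (U n) p <-> S p n.
Proof.
  intros [c Hc]%computable_code.
  pose (Q n i v := eval (fun _ => n) c i v).
  exists (fun p n => accept (Q n) (graph p)). split.
  - apply (semidec_accept (fun _ n => Q n) (fun p n => graph p));
    unfold semidec_rel, graph, Q; [|semidec_auto].
    apply (semidec_ext (fun p z => derives (fun _ v => v = fstn z)
      (fact (encode c) (fstn (sndn z)) (sndn (sndn z))))).
    + unfold fact. apply (semidec_derives (fun p z _ v => v = fstn z)); semidec_auto.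
    + intros p z. split.
      * apply eval_derives; [reflexivity | apply decode_encode].
      * intros H. apply (derives_eval _ (fun _ => fstn z)) in H; [|auto].
        unfold fact in H. prs. rewrite decode_encode in H. exact H.
  - intros p n. destruct (Hc (fun _ => n) n eq_refl) as (q & Hq & HU).
    assert (Q n = graph q) as ->.
    { apply functional_extensionality. intros i. apply functional_extensionality.
      intros v. apply propositional_extensionality. unfold Q, graph. split.
      - intros H. exact (eval_fun _ _ _ _ _ H (Hq i)).
      - intros ->. apply Hq. }
    apply (accept_iff baire_space q (U n) p p HU eq_refl).
Qed.

Lemma semidec_of_pi02 P : pi02 baire_space P -> exists K L, semidec K /\ semidec L /\
  forall p, P p <-> forall n, K p n -> L p n.
Proof.
  intros (U & V & HU & HV & E).
  destruct (semidec_of_computable_opens U HU) as (K & HK & EK).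
  destruct (semidec_of_computable_opens V HV) as (L & HL & EL).
  exists K, L. split; [|split]; trivial. intros p. rewrite E.
  split; intros H n; specialize (H n); rewrite EK, EL in *; exact H.
Qed.

Lemma delta_opens_ran q (U : opens opens_nat) :
  delta (opens opens_nat) q U -> exists V : opens baire_space,
    delta (opens baire_space) q V /\ forall p, set_of V p <-> set_of U (ran p).
Proof.
  intros HU.
  assert (HO : is_open baire_space (fun p => set_of U (ran p))).
  { intros p y -> Up. destruct (proj2_sig U p (ran p)) as [n Hn]; trivial.
    - apply delta_opens_nat. reflexivity.
    - exists n. intros p' y' -> A. apply (Hn p'); trivial. apply delta_opens_nat. reflexivity. }
  exists (exist _ _ HO). split; [|reflexivity].
  intros p y ->. apply (HU p (ran p)), delta_opens_nat. reflexivity.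
Qed.

(* The names of an open set of sets are also names of its preimage under [ran]. *)
Lemma computable_opens_ran (U : nat_space -> opens opens_nat) : computable U ->
  exists V : nat_space -> opens baire_space, computable V /\
    forall n p, set_of (V n) p <-> set_of (U n) (ran p).
Proof.
  intros [c Hc]%computable_code.
  assert (HO : forall n, exists V : opens baire_space,
    forall p, set_of V p <-> set_of (U n) (ran p)).
  { intros n. destruct (name_surj (delta (opens opens_nat)) (U n)) as [q Hq].
    destruct (delta_opens_ran q _ Hq) as (V & _ & E). eauto. }
  pose (V n := proj1_sig (constructive_indefinite_description _ (HO n))).
  assert (HV : forall n p, set_of (V n) p <-> set_of (U n) (ran p)).
  { intros n. exact (proj2_sig (constructive_indefinite_description _ (HO n))). }
  exists V. split; trivial. apply computable_code. exists c. intros p n Hp.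
  destruct (Hc p n Hp) as (q & Hq & HU). exists q. split; trivial.
  destruct (delta_opens_ran q _ HU) as (W & HW & E).
  (* A set is determined by its members, so the name computed for [W] also names the classically
     chosen [V n]. *)
  replace (V n) with W; trivial. apply sig_eq, functional_extensionality. intros z.
  apply propositional_extensionality. fold (set_of W z) (set_of (V n) z).
  rewrite E, HV. tauto.
Qed.

Lemma pi02_ran P : pi02 opens_nat P -> pi02 baire_space (fun p => P (ran p)).
Proof.
  intros (U & V & HU & HV & E).
  destruct (computable_opens_ran U HU) as (U' & HU' & EU).
  destruct (computable_opens_ran V HV) as (V' & HV' & EV).
  exists U', V'. split; [|split]; trivial. intros p. rewrite E.
  split; intros H n; specialize (H n); rewrite EU, EV in *; exact H.
Qed.

(** * Reduction of open conditions to finite subsets *)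

Definition included (s : nat) (A : nat -> Prop) : Prop := forall y, els s y -> A y.

Lemma included_bounded s A : included s A <->
  forall j, j < s -> hd (drop j s) = 0 \/ A (pred (hd (drop j s))).
Proof.
  split.
  - intros H j L. destruct (hd (drop j s)) as [|y] eqn:E; [auto|].
    right. apply H. exists j. exact E.
  - intros H y (j & L & E)%els_lt. specialize (H j L). rewrite E in H.
    destruct H as [H|H]; [discriminate|exact H].
Qed.

Lemma semidec_included F A : recursive F -> semidec (fun p z => A p (fstn z) (sndn z)) ->
  semidec (fun p n => included (F p n) (A p n)).
Proof.
  intros HF HA.
  apply (semidec_ext (fun p n => forall j, j < F p n ->
    hd (drop j (F p n)) = 0 \/ A p n (pred (hd (drop j (F p n)))))).
  - apply semidec_ball; trivial. apply semidec_or; [semidec_auto|].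
    apply (semidec_ext (fun p z => (fun p w => A p (fstn w) (sndn w)) p
      (pr (fstn z) (pred (hd (drop (sndn z) (F p (fstn z)))))))).
    + apply (semidec_comp _ _ HA). semidec_auto.
    + intros p z. prs. reflexivity.
  - intros p n. apply included_bounded.
Qed.

(** Prepending [s] to the enumeration [p] adds no new element. *)
Lemma included_extend s p : included s (ran p) ->
  exists p' k, prefix p' k = s /\ ran p' = ran p.
Proof.
  intros H. destruct (prefix_extend s p) as (p' & k & <- & E). exists p', k.
  split; trivial. apply functional_extensionality. intros y.
  apply propositional_extensionality. split.
  - intros [i Hi]. destruct (Nat.lt_ge_cases i k) as [L|L].
    + apply H, els_prefix. eauto.
    + exists (i - k). rewrite <- E, <- Hi. f_equal. lia.
  - intros [i Hi]. exists (k + i). rewrite E. exact Hi.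
Qed.

Lemma included_prefix p k : included (prefix p k) (ran p).
Proof. intros y (i & _ & H)%els_prefix. exists i. exact H. Qed.

Lemma semidec_set_finite (K : (nat -> Prop) -> nat -> Prop) : semidec_set K ->
  exists H : nat -> nat -> Prop, semidec (fun _ z => H (fstn z) (sndn z)) /\
    forall A n, K A n <-> exists s, included s A /\ H s n.
Proof.
  intros HK. destruct (finite_use _ HK) as (H & HH & E & _). exists H. split; trivial.
  intros A n. destruct (name_surj (delta opens_nat) A) as [p ->%delta_opens_nat].
  rewrite E. split.
  - intros [k Hk]. exists (prefix p k). split; trivial. apply included_prefix.
  (* Acceptance of [s] concerns an enumeration starting with [s]; it transfers to [p] because both
     have the same range. *)
  - intros (s & Hs & Hn). destruct (included_extend s p Hs) as (p' & k & <- & Er).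
    apply E. rewrite <- Er. apply E. eauto.
Qed.

Lemma pi02_finite P : pi02 opens_nat P -> exists H L : nat -> nat -> Prop,
  semidec (fun _ z => H (fstn z) (sndn z)) /\ semidec (fun _ z => L (fstn z) (sndn z)) /\
  forall A, P A <-> forall n, (exists s, included s A /\ H s n) ->
    exists s, included s A /\ L s n.
Proof.
  intros (U & V & HU & HV & E).
  assert (fin : forall U : nat_space -> opens opens_nat, computable U ->
    exists H : nat -> nat -> Prop, semidec (fun _ z => H (fstn z) (sndn z)) /\
      forall A n, set_of (U n) A <-> exists s, included s A /\ H s n).
  { clear. intros U (U' & HU & EU)%computable_opens_ran.
    destruct (semidec_of_computable_opens U' HU) as (S & HS & ES).
    apply (semidec_set_finite (fun A n => set_of (U n) A)).
    apply (semidec_ext S); trivial. intros p n. rewrite <- EU. apply ES. }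
  destruct (fin U HU) as (H & HH & EH), (fin V HV) as (L & HL & EL).
  exists H, L. split; [|split]; trivial. intros A. rewrite E.
  split; intros HA n; specialize (HA n); rewrite EH, EL in *; exact HA.
Qed.

(** * Rounded ideals *)

Lemma semidec_pi02_rounded_ideal R : ce_rel R -> semidec_pi02 (rounded_ideal R).
Proof.
  intros [c Hc].
  assert (HR : forall F G, recursive F -> recursive G ->
    semidec (fun p n => R (F p n) (G p n))).
  { intros F G HF HG.
    apply (semidec_ext _ _ (semidec_comp _ _ (semidec_ce c) (recursive_pr _ _ HF HG))).
    intros p n. rewrite <- Hc. fold (fstn (pr (F p n) (G p n))) (sndn (pr (F p n) (G p n))).
    prs. reflexivity. }
  (* The trivial premise [n = n] brings nonemptiness into the form of an implication. *)
  assert (H : semidec_pi02 (fun A =>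
    (forall n : nat, n = n -> exists x, A x) /\
    (forall n, A (sndn n) /\ R (fstn n) (sndn n) -> A (fstn n)) /\
    (forall n, A (fstn n) /\ A (sndn n) -> exists z, A z /\ R (fstn n) z /\ R (sndn n) z))).
  { repeat apply semidec_pi02_and; apply semidec_pi02_imp; unfold semidec_set;
      repeat first [apply HR | semidec_rel_step]. }
  destruct H as (K & L & HK & HL & E). exists K, L. split; [|split]; trivial.
  intros A. rewrite <- E. unfold rounded_ideal. split.
  - intros (H1 & H2 & H3). split; [auto|]. split.
    + intros n [Ha Hr]. eauto.
    + intros n [Hx Hy]. auto.
  - intros (H1 & H2 & H3). split; [apply (H1 0 eq_refl)|]. split.
    + intros x y Hy Hr. specialize (H2 (pr x y)). prs. auto.
    + intros x y Hx Hy. specialize (H3 (pr x y)). prs. auto.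
Qed.

Lemma els_union s t : exists u, forall y, els u y <-> els s y \/ els t y.
Proof.
  induction s as [|h s [u IH]] using coded_list_ind.
  - exists t. intros y. split; [auto|]. intros [H|H]; trivial. destruct (els_nil _ H).
  - exists (cons h u). intros y. rewrite !els_cons, IH. tauto.
Qed.

Section Ideals.

Variables (G : nat -> nat) (L : nat -> nat -> Prop).

(* The index [k = <<s,n>,t>] stands for the condition "if the finite set [s] is contained
   in [A], then [A] meets [L _ n]", which is active if [G k = 0], i.e. if the witness [t]
   puts [s] into the n-th open set. *)
Definition meets (A : nat -> Prop) : Prop :=
  forall k, G k = 0 -> included (fstn (fstn k)) A ->
    exists s, included s A /\ L s (sndn (fstn k)).

Definition token_rel (x y : nat) : Prop :=
  included (fstn x) (els (fstn y)) /\ sndn x < sndn y /\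
  forall k, k < sndn x ->
    G k <> 0 \/ ~ included (fstn (fstn k)) (els (fstn x)) \/
    exists s, included s (els (fstn y)) /\ L s (sndn (fstn k)).

Definition tokens (A : nat -> Prop) (x : nat) : Prop := included (fstn x) A.
Definition points (I : nat -> Prop) (y : nat) : Prop := exists x, I x /\ els (fstn x) y.

Lemma token_rel_trans : transitive_rel token_rel.
Proof.
  intros x y z (H1 & H2 & H3) (H1' & H2' & H3'). split; [|split].
  - intros v Hv. auto.
  - lia.
  - intros k Lk. destruct (H3 k Lk) as [H|[H|(s & Hs & HL)]]; auto.
    right. right. exists s. split; trivial. intros v Hv. auto.
Qed.

(** Each condition below [n] triggered by [F] contributes a finite subset of [A]. Conditions
    triggered only by the enlarged set are not considered, so one pass suffices. *)
Lemma tokens_cover A n : meets A -> forall F, included F A ->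
  exists F', included F' A /\ included F (els F') /\
    forall k, k < n -> G k = 0 -> included (fstn (fstn k)) (els F) ->
      exists s, included s (els F') /\ L s (sndn (fstn k)).
Proof.
  intros HA F HF. induction n as [|n (F' & H1 & H2 & H3)].
  - exists F. split; [|split]; trivial; [intros y; trivial | intros; lia].
  - destruct (classic (G n = 0 /\ included (fstn (fstn n)) (els F))) as [[H0 Hn]|N].
    + destruct (HA n H0) as (s & Hs & HL); [intros y Hy; auto|].
      destruct (els_union s F') as [u Hu]. exists u. split; [|split].
      * intros y [Hy|Hy]%Hu; auto.
      * intros y Hy. apply Hu. auto.
      * intros k Lk Gk Hk. destruct (Nat.eq_dec k n) as [->|Nk].
        -- exists s. split; trivial. intros y Hy. apply Hu. auto.
        -- destruct (H3 k ltac:(lia) Gk Hk) as (s' & Hs' & HL'). exists s'.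
           split; trivial. intros y Hy. apply Hu. auto.
    + exists F'. split; [|split]; trivial. intros k Lk Gk Hk.
      destruct (Nat.eq_dec k n) as [->|Nk]; [tauto|]. apply H3; trivial. lia.
Qed.

Lemma tokens_ideal A : meets A -> rounded_ideal token_rel (tokens A).
Proof.
  intros HA. split; [|split].
  - exists (pr 0 0). unfold tokens. prs. intros y Hy. destruct (els_nil _ Hy).
  - intros x y Hy (H & _) v Hv. auto.
  - intros x y Hx Hy. destruct (els_union (fstn x) (fstn y)) as [F EF].
    destruct (tokens_cover A (sndn x + sndn y) HA F) as (F' & H1 & H2 & H3).
    { intros v [Hv|Hv]%EF; auto. }
    (* [F'] answers all conditions below the sum, hence those demanded by either token; the
       successor makes the level strictly larger than both. *)
    exists (pr F' (S (sndn x + sndn y))).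
    assert (rel : forall w, included (fstn w) (els F) -> sndn w <= sndn x + sndn y ->
      token_rel w (pr F' (S (sndn x + sndn y)))).
    { intros w Hw Lw. unfold token_rel. prs. split; [|split]; [|lia|].
      - intros v Hv. auto.
      - intros k Lk. destruct (Nat.eq_dec (G k) 0) as [Gk|Gk]; [|auto]. right.
        destruct (classic (included (fstn (fstn k)) (els (fstn w)))) as [Hk|Hk]; [|auto].
        right. apply H3; trivial; [lia|]. intros v Hv. auto. }
    split; [|split].
    + unfold tokens. prs. exact H1.
    + apply rel; [intros v Hv; apply EF; auto | lia].
    + apply rel; [intros v Hv; apply EF; auto | lia].
Qed.

Section Ideal.

Variable (I : nat -> Prop).
Hypothesis (HI : rounded_ideal token_rel I).

(** Directedness gathers finitely many points in one token, and going up in the ideal raises the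
    level past any [n]. *)
Lemma ideal_finite n s : included s (points I) ->
  exists x, I x /\ included s (els (fstn x)) /\ n <= sndn x.
Proof.
  destruct HI as (H1 & H2 & H3). intros Hs.
  assert (exists x, I x /\ included s (els (fstn x))) as (x & Hx & Hsx).
  { induction s as [|h t IH] using coded_list_ind.
    - destruct H1 as [x Hx]. exists x. split; trivial. intros y Hy. destruct (els_nil _ Hy).
    - destruct IH as (x & Hx & Hsx); [intros y Hy; apply Hs, els_cons; auto|].
      destruct h as [|v].
      + exists x. split; trivial. intros y [E|Hy]%els_cons; [discriminate|auto].
      + destruct (Hs v) as (x' & Hx' & Hv); [apply els_cons; auto|].
        destruct (H3 x x' Hx Hx') as (z & Hz & [R1 _] & [R2 _]).
        exists z. split; trivial. intros y [[= <-]|Hy]%els_cons; auto. }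
  induction n as [|n (z & Hz & Hsz & Lz)]; [exists x; split; [|split]; trivial; lia|].
  destruct (H3 z z Hz Hz) as (w & Hw & (R1 & R2 & _) & _).
  exists w. split; [|split]; trivial; [|lia]. intros y Hy. auto.
Qed.

(** A token of the ideal that contains the trigger and has level above [k] forces any token above it
    to satisfy condition [k]. *)
Lemma points_meets : meets (points I).
Proof.
  intros k Gk Hk. destruct (ideal_finite (S k) _ Hk) as (x & Hx & Hkx & Lx).
  destruct HI as (H1 & H2 & H3).
  destruct (H3 x x Hx Hx) as (z & Hz & (_ & _ & R) & _).
  destruct (R k Lx) as [N|[N|(s & Hs & HL)]]; [contradiction|contradiction|].
  exists s. split; trivial. intros y Hy. exists z. auto.
Qed.

(** If the finite set of [x] consists of points, it lies in a token [y] of the ideal of higher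
    level. Whatever is above [y] is above [x] too, since a condition triggered by [x] is also
    triggered by [y]; downward closure then gives [x]. *)
Lemma tokens_points : tokens (points I) = I.
Proof.
  destruct HI as (H1 & H2 & H3).
  apply functional_extensionality. intros x. apply propositional_extensionality. split.
  - intros Hx. destruct (ideal_finite (S (sndn x)) _ Hx) as (y & Hy & Hxy & Ly).
    destruct (H3 y y Hy Hy) as (z & Hz & (R1 & R2 & R3) & _).
    apply (H2 x z Hz). split; [|split].
    + intros v Hv. auto.
    + lia.
    + intros k Lk. destruct (R3 k ltac:(lia)) as [N|[N|H]]; auto.
      right. left. intros Hk. apply N. intros v Hv. auto.
  - intros Hx v Hv. exists x. auto.
Qed.

End Ideal.

Lemma points_tokens A : points (tokens A) = A.
Proof.
  apply functional_extensionality. intros y. apply propositional_extensionality. split.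
  - intros (x & Hx & Hy). auto.
  - intros Hy. exists (pr (cons (S y) 0) 0). unfold tokens. prs. split.
    + intros v [[= <-]|Hv]%els_cons; trivial. destruct (els_nil _ Hv).
    + apply els_cons. auto.
Qed.

Lemma isomorphic_RI (P : (nat -> Prop) -> Prop) : (forall A, P A <-> meets A) ->
  isomorphic (subspace opens_nat P) (RI token_rel).
Proof.
  intros HP.
  exists (fun A => exist (rounded_ideal token_rel) (tokens (proj1_sig A))
    (tokens_ideal _ (proj1 (HP _) (proj2_sig A)))).
  split; [|exists (fun I : RI token_rel => exist P (points (proj1_sig I))
    (proj2 (HP _) (points_meets _ (proj2_sig I)))); split; [|split]].
  - apply (computable_into_sets _ _ _ (fun p x => included (fstn x) (ran p))).
    + apply (semidec_included _ (fun p _ => ran p)); semidec_solve.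
    + intros p A H%delta_sets x. rewrite <- H. reflexivity.
  - apply (computable_into_sets _ _ _ (fun p y => exists x, ran p x /\ els (fstn x) y)).
    + semidec_solve.
    + intros p A H%delta_sets x. rewrite <- H. reflexivity.
  - intros A. apply sig_eq. apply points_tokens.
  - intros I. apply sig_eq. cbn. apply tokens_points, (proj2_sig I).
Qed.

(** The negated parts are decidable: [G] is recursive, and inclusion between finite sets fails
    exactly if some element is missed at every position below the code. *)
Lemma ce_token_rel : recursive (fun _ => G) -> semidec (fun _ z => L (fstn z) (sndn z)) ->
  ce_rel token_rel.
Proof.
  intros HG HL. apply ce_of_semidec.
  apply (semidec_ext (fun _ n => included (fstn (fstn n)) (els (fstn (sndn n))) /\
    sndn (fstn n) < sndn (sndn n) /\
    forall k, k < sndn (fstn n) ->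
      G k <> 0 \/ (exists y, els (fstn (fstn k)) y /\
        forall j, j < fstn (fstn n) -> hd (drop j (fstn (fstn n))) <> S y) \/
      exists s, included s (els (fstn (sndn n))) /\ L s (sndn (fstn k)))).
  - assert (HL' : forall A B, recursive A -> recursive B ->
    semidec (fun p n => L (A p n) (B p n))).
    { intros A B HA HB. apply (semidec_ext _ _ (semidec_comp _ _ HL (recursive_pr _ _ HA HB))).
      intros p n. prs. reflexivity. }
    assert (HG' : forall A, recursive A -> recursive (fun p n => G (A p n))).
    { intros A. apply (recursive_comp (fun _ => G)), HG. }
    assert (HI : forall A B, recursive A -> recursive B ->
      semidec (fun p n => included (A p n) (els (B p n)))).
    { intros A B HA HB. apply (semidec_included A (fun p n => els (B p n))); semidec_solve. }
    repeat first [apply HL' | apply HG' | apply HI | semidec_rel_step].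
  - intros p n. fold (fstn n) (sndn n). unfold token_rel.
    assert (E : forall s t, ~ included s (els t) <->
      exists y, els s y /\ forall j, j < t -> hd (drop j t) <> S y).
    { intros s t. split.
      - intros N. apply not_all_ex_not in N as [y N]. apply imply_to_and in N as [Hy N].
        exists y. split; trivial. intros j _ E. apply N. exists j. exact E.
      - intros (y & Hy & N) H. apply H, els_lt in Hy as (j & Lj & E). exact (N j Lj E). }
    split; intros (H1 & H2 & H3); (split; [|split]); trivial; intros k Lk;
      specialize (H3 k Lk); rewrite E in *; exact H3.
Qed.

End Ideals.

Lemma pi02_RI P : pi02 opens_nat P -> exists R,
  transitive_rel R /\ ce_rel R /\ isomorphic (subspace opens_nat P) (RI R).
Proof.
  intros (H & L & (G & HG & EG) & HL & E)%pi02_finite.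
  (* [H] does not depend on an oracle, so its stages can be computed with the constant oracle 0. *)
  pose (G0 := G (fun _ => 0)).
  exists (token_rel G0 L). split; [apply token_rel_trans|]. split.
  - apply ce_token_rel; trivial.
    exact (recursive_subst (fun _ _ => 0) G (recursive_const 0) HG).
  - apply isomorphic_RI. intros A. rewrite E. unfold meets, G0. split.
    + intros HA k Gk Hk. apply HA. exists (fstn (fstn k)). split; trivial.
      specialize (EG (fun _ => 0) (fstn k)). apply EG. exists (sndn k). prs. exact Gk.
    + intros HA n (s & Hs & Hn).
      specialize (EG (fun _ => 0) (pr s n)). prs. apply EG in Hn as [t Ht].
      specialize (HA (pr (pr s n) t) Ht). prs. auto.
Qed.

(** * From sets to representations *)

(** Open sets cannot tell a set from its closure, so overtness of a closed fiber speaks about the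
    names themselves. *)
Lemma closure_hit (X : repspace) (A : X -> Prop) (V : opens X) :
  (exists y, set_of V y /\ closure X A y) <-> exists y, set_of V y /\ A y.
Proof.
  split.
  - intros (y & Vy & Cy). exact (Cy _ (proj2_sig V) Vy).
  - intros (y & Vy & Ay). exists y. split; trivial. intros U _ Uy. eauto.
Qed.

Section SetRepresentation.

Variables (X : repspace) (P : opens_nat -> Prop).
Variables (f : X -> subspace opens_nat P) (g : subspace opens_nat P -> X).
Hypotheses (Hf : computable f) (Hg : computable g).
Hypotheses (gf : forall x, g (f x) = x) (fg : forall A, f (g A) = A).

Definition enum_rep : representation X.
Proof.
  refine (Representation (fun p x => delta (subspace opens_nat P) p (f x)) _ _).
  - intros p x y Hx Hy. rewrite <- (gf x), <- (gf y). f_equal.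
    exact (name_fun _ _ _ _ Hx Hy).
  - intros x. apply name_surj.
Defined.

Lemma enum_rep_ran p x : enum_rep p x <-> proj1_sig (f x) = ran p.
Proof. apply delta_sets. Qed.

(** A name of [x] is a name of [f x], so the programs for [f] and [g] compute the identity in the
    two directions. *)
Lemma admits_enum_rep : admits X enum_rep.
Proof.
  split.
  - apply computable_code in Hf as [c Hc]. apply computable_code. exists c. exact Hc.
  - exists (fun x => x). split; [|split; reflexivity].
    apply computable_code in Hg as [c Hc]. apply computable_code. exists c.
    intros p x Hp. destruct (Hc p (f x) Hp) as (q & Hq & H). rewrite gf in H. eauto.
Qed.

(** An open set meets the fiber of [x] iff it accepts some finite sequence with entries in [f x],
    and any name of [x] enumerates these sequences. *)
Lemma fiber_overt_enum_rep : fiber_overt enum_rep.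
Proof.
  destruct (semidec_opens_name (fun p _ => exists s, included s (ran (left_half p)) /\
    accept (graph (right_half p)) (entry s))) as [e He].
  { apply semidec_ex, semidec_and.
    - apply (semidec_included _ (fun p _ => ran (left_half p))); unfold ran, left_half;
      semidec_solve.
    - apply (semidec_accept (fun p _ => graph (right_half p)) (fun _ z => entry (sndn z)));
        unfold semidec_rel, graph, right_half; semidec_solve. }
  apply (computable_of_recursive (RepSpace X enum_rep) (overt baire_space) _ (opname e)).
  - apply (recursive_opname e _ recursive_id).
  - intros p x Hp%enum_rep_ran. apply He. intros q V HV.
    rewrite left_half_join, right_half_join.
    change (set_of (hit baire_space (proj1_sig (fiber_closure enum_rep x))) V) with
      (exists y, set_of V y /\ closure baire_space (fun p => enum_rep p x) y).
    rewrite closure_hit. split.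
    + intros (y & Vy & Hy%enum_rep_ran).
      apply (accept_finite baire_space q V y y HV eq_refl) in Vy as [k Hk].
      exists (prefix y k). split; trivial. rewrite <- Hp, Hy. apply included_prefix.
    + intros (s & Hs & Ha). destruct (included_extend s p Hs) as (y & k & <- & Ey).
      exists y. split.
      * apply (accept_finite baire_space q V y y HV eq_refl). eauto.
      * apply enum_rep_ran. congruence.
Qed.

Lemma member_open n : is_open (RepSpace X enum_rep) (fun x => proj1_sig (f x) n).
Proof.
  apply (semidec_is_open _ _ (fun p _ => ran p n)).
  - apply semidec_ran, recursive_const.
  - intros p x Hp%enum_rep_ran. rewrite <- Hp. reflexivity.
Qed.

(** The sets [V n] of all [x] with [n] in [f x] are uniformly open; testing which of them belong to
    the neighborhood filter enumerates [f x]. *)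
Lemma computably_admissible_enum_rep : computably_admissible enum_rep.
Proof.
  pose (Xd := RepSpace X enum_rep).
  pose (V n := exist (is_open Xd) _ (member_open n) : opens Xd).
  split.
  - intros x y E. rewrite <- (gf x), <- (gf y). f_equal.
    apply sig_eq, functional_extensionality. intros n.
    apply (f_equal (fun W => set_of W (V n))) in E. exact E.
  - destruct (semidec_hits (fun p n => ran p n)) as (T & HT & HE).
    { apply semidec_ran, recursive_id. }
    destruct (semidec_enumeration T HT) as (F & [c Hc] & HF).
    apply computable_mv_code. exists c. intros Q W HQ [x ->].
    exists (F Q), x. split; [apply Hc|]. split; [|reflexivity].
    apply enum_rep_ran, functional_extensionality. intros n.
    apply propositional_extensionality. rewrite HF.
    apply (fun H => HE Xd V H Q _ HQ n).
    intros z y m Hz%enum_rep_ran. rewrite <- Hz. reflexivity.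
Qed.

Lemma dom_enum_rep : dom enum_rep = fun p => P (ran p).
Proof.
  apply functional_extensionality. intros p. apply propositional_extensionality. split.
  - intros [x Hx%enum_rep_ran]. rewrite <- Hx. apply (proj2_sig (f x)).
  - intros H. exists (g (exist P (ran p) H)). apply enum_rep_ran. rewrite fg. reflexivity.
Qed.

End SetRepresentation.

Lemma pi02_representation (X : repspace) P : pi02 opens_nat P ->
  isomorphic X (subspace opens_nat P) ->
  exists d : representation X,
    admits X d /\ fiber_overt d /\ computably_admissible d /\ pi02 baire_space (dom d).
Proof.
  intros HP (f & Hf & g & Hg & gf & fg). exists (enum_rep X P f g gf).
  split; [|split; [|split]].
  - apply admits_enum_rep; trivial.
  - apply fiber_overt_enum_rep.
  - apply computably_admissible_enum_rep.
  - rewrite (dom_enum_rep X P f g gf fg). apply pi02_ran, HP.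
Qed.

(** * From representations to sets *)

(** Here [t] is the longer sequence: codes list entries backwards, so initial segments arise by
    dropping from the front. *)
Definition extends (s t : nat) : Prop := exists j, drop j t = s.

Lemma extends_prefix p k k' : k <= k' -> extends (prefix p k) (prefix p k').
Proof.
  intros L. exists (k' - k). rewrite drop_prefix. f_equal. lia.
Qed.

Lemma extends_inv s p k : extends s (prefix p k) -> exists k', k' <= k /\ s = prefix p k'.
Proof. intros [j <-]. exists (k - j). rewrite drop_prefix. split; trivial. lia. Qed.

Lemma extends_common s t : extends s t ->
  exists p k k', k <= k' /\ s = prefix p k /\ t = prefix p k'.
Proof.
  intros H. destruct (prefix_extend t (fun _ => 0)) as (p & k' & <- & _).
  destruct (extends_inv _ _ _ H) as (k & L & ->). exists p, k, k'. auto.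
Qed.

Lemma extends_refl s : extends s s.
Proof. exists 0. reflexivity. Qed.

Lemma extends_trans s t u : extends s t -> extends t u -> extends s u.
Proof.
  intros H (p & k & k' & L & -> & ->)%extends_common.
  apply extends_inv in H as (j & L' & ->). apply extends_prefix. lia.
Qed.

Lemma extends_cons v s : extends s (cons v s).
Proof. exists 1. apply tl_cons. Qed.

Lemma extends_limit (s : nat -> nat) :
  (forall i, exists v, extends (cons v (s i)) (s (S i))) ->
  exists p, forall i, exists k, i <= k /\ prefix p k = s i.
Proof.
  intros H.
  assert (Hx : forall i, exists pk : baire * nat, prefix (fst pk) (snd pk) = s i).
  { intros i. destruct (prefix_extend (s i) (fun _ => 0)) as (p & k & E & _).
    exists (p, k). exact E. }
  pose (c i := proj1_sig (constructive_indefinite_description _ (Hx i))).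
  assert (Hc : forall i, prefix (fst (c i)) (snd (c i)) = s i).
  { intros i. exact (proj2_sig (constructive_indefinite_description _ (Hx i))). }
  clearbody c. clear Hx.
  assert (mono : forall i j, i <= j -> extends (s i) (s j)).
  { intros i j L. induction L as [|j L IH]; [apply extends_refl|].
    destruct (H j) as [v Hv]. apply (extends_trans _ (s j)); trivial.
    apply (extends_trans _ (cons v (s j))); trivial. apply extends_cons. }
  assert (Hag : forall i j, i <= j -> agree (snd (c i)) (fst (c i)) (fst (c j))).
  { intros i j L. specialize (mono i j L). rewrite <- !Hc in mono.
    apply extends_inv in mono as (k & _ & E). apply prefix_inj in E. tauto. }
  assert (len : forall i, i <= snd (c i)).
  { intros i. induction i as [|i IH]; [lia|].
    destruct (H i) as [v Hv]. rewrite <- (Hc i), <- (Hc (S i)) in Hv.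
    apply extends_inv in Hv as (k & Lk & E).
    destruct k as [|k]; [discriminate|]. rewrite prefix_S in E.
    apply (f_equal tl) in E. rewrite !tl_cons in E. apply prefix_inj in E. lia. }
  (* Each step adds an entry, so [s (S i)] has length at least [S i] and already fixes the value at
     [i]. *)
  exists (fun i => fst (c (S i)) i). intros i. exists (snd (c i)). split; [apply len|].
  rewrite <- Hc. apply agree_prefix. intros j Lj.
  pose proof (len (S j)). destruct (Nat.le_ge_cases i (S j)) as [L|L].
  - symmetry. apply (Hag i (S j)); trivial.
  - apply (Hag (S j) i); trivial.
Qed.

(* Baire category: a pruned tree in which all requirements are dense has a branch
   that meets all of them. *)
Lemma generic_branch (A : nat -> Prop) (H L E : nat -> nat -> Prop) :
  (forall s t n, extends s t -> H s n -> H t n) ->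
  (forall s t n, extends s t -> L s n -> L t n) ->
  A 0 -> (forall s, A s -> A (tl s)) -> (forall s, A s -> exists v, A (cons v s)) ->
  (forall s n, A s -> H s n -> exists t, A t /\ extends s t /\ L t n) ->
  (forall s u, A s -> A u -> exists t, A t /\ extends s t /\ E t u) ->
  exists p, (forall k, A (prefix p k)) /\
    (forall n k, H (prefix p k) n -> exists l, L (prefix p l) n) /\
    (forall u, A u -> exists l, E (prefix p l) u).
Proof.
  intros monoH monoL A0 Atl Acons HL HE.
  (* Stage [i] adds an entry, meets requirement [fstn i] if the node triggers it, and then handles
     the element [sndn i]. Outside the tree any value serves, which makes [next] total. *)
  assert (step : forall i s, exists t, A s -> A t /\ (exists v, extends (cons v s) t) /\
    (H s (fstn i) -> L t (fstn i)) /\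
    (A (sndn i) -> exists t', extends t' t /\ E t' (sndn i))).
  { intros i s. destruct (classic (A s)) as [As|N]; [|exists 0; tauto].
    destruct (Acons s As) as [v Av].
    assert (exists t, A t /\ extends (cons v s) t /\ (H s (fstn i) -> L t (fstn i)))
      as (t & At & Et & HLt).
    { destruct (classic (H s (fstn i))) as [Hs|N].
      - destruct (HL (cons v s) (fstn i) Av) as (t & At & Et & Lt).
        + apply (monoH s); trivial. apply extends_cons.
        + exists t. auto.
      - exists (cons v s). split; [|split]; trivial; [apply extends_refl|tauto]. }
    destruct (classic (A (sndn i))) as [Ai|N].
    - destruct (HE t (sndn i) At Ai) as (t' & At' & Et' & HEt).
      exists t'. intros _. split; [|split; [|split]]; trivial.
      + exists v. apply (extends_trans _ t); trivial.
      + intros Hs. apply (monoL t); auto.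
      + intros _. exists t'. split; trivial. apply extends_refl.
    - exists t. intros _. split; [|split; [|split]]; eauto. tauto. }
  pose (next i s := proj1_sig (constructive_indefinite_description _ (step i s))).
  assert (Hnext : forall i s, A s -> A (next i s) /\
    (exists v, extends (cons v s) (next i s)) /\
    (H s (fstn i) -> L (next i s) (fstn i)) /\
    (A (sndn i) -> exists t', extends t' (next i s) /\ E t' (sndn i))).
  { intros i s. exact (proj2_sig (constructive_indefinite_description _ (step i s))). }
  clearbody next. clear step.
  pose (s := nat_rect (fun _ => nat) 0 next).
  assert (As : forall i, A (s i)).
  { intros i. induction i as [|i IH]; trivial. apply (Hnext i (s i) IH). }
  destruct (extends_limit s) as [p Hp].
  { intros i. apply (Hnext i (s i) (As i)). }
  assert (Adrop : forall j t, A t -> A (drop j t)).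
  { intros j t At. induction j as [|j IH]; trivial. apply Atl, IH. }
  exists p. split; [|split].
  - intros k. destruct (Hp k) as (l & Ll & E'). specialize (As k).
    rewrite <- E' in As. destruct (extends_prefix p k l Ll) as [j <-]. auto.
  (* Stage [pr n k] is at least [k], so its node already contains the prefix of length [k] that
     triggers [H]. *)
  - intros n k Hk. destruct (Hnext (pr n k) (s (pr n k)) (As _)) as (_ & _ & HLn & _).
    prs. destruct (Hp (pr n k)) as (l & Ll & E').
    destruct (Hp (S (pr n k))) as (l' & _ & E''). exists l'. rewrite E''. apply HLn.
    rewrite <- E'. apply (monoH (prefix p k)); trivial. apply extends_prefix.
    pose proof (to_nat_non_decreasing n k). lia.
  - intros u Au. destruct (Hnext (pr 0 u) (s (pr 0 u)) (As _)) as (_ & _ & _ & HEu).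
    prs. destruct (HEu Au) as (t' & Et & HEt).
    destruct (Hp (S (pr 0 u))) as (l' & _ & E').
    change (next (pr 0 u) (s (pr 0 u))) with (s (S (pr 0 u))) in Et.
    rewrite <- E' in Et. apply extends_inv in Et as (k & _ & ->). eauto.
Qed.

Section FiberTrees.

Variables (X : Type) (d : representation X).
Let Xd : repspace := RepSpace X d.

Definition fiber_tree (x : X) (s : nat) : Prop := exists p k, d p x /\ prefix p k = s.

Lemma fiber_tree_prefix p x k : d p x -> fiber_tree x (prefix p k).
Proof. intros H. exists p, k. auto. Qed.

(** A sequence lies in the tree iff the basic open set it determines meets the fiber, which
    overtness makes semidecidable. *)
Lemma semidec_fiber_tree : fiber_overt d -> exists S, semidec S /\
  forall p x, d p x -> forall s, fiber_tree x s <-> S p s.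
Proof.
  intros Hd.
  assert (HO : forall s, is_open baire_space (fun p => exists k, prefix p k = s)).
  { intros s p y -> [k <-]. exists k. intros p' y' -> A. exists k.
    symmetry. apply agree_prefix, A. }
  pose (V s := exist (is_open baire_space) _ (HO s) : opens baire_space).
  destruct (semidec_hits (fun p s => exists k, prefix p k = s)) as (T & HT & HE).
  { semidec_auto. }
  (* The subspace cut out by [True] is all of O(N), in the form required by the lemmas on maps into
     subspaces. *)
  pose (h (A : overt baire_space) :=
    exist (fun _ : opens_nat => True) (fun s => set_of (hit baire_space (proj1_sig A)) (V s)) I
    : subspace opens_nat (fun _ => True)).
  assert (Hh : computable h).
  { apply (computable_into_sets _ _ _ T HT). intros q A HA s.
    apply (fun H => HE baire_space V H q _ HA s). intros z y n ->. reflexivity. }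
  destruct (semidec_of_computable _ _ _ (computable_comp _ _ _ _ _ Hd Hh)) as (S & HS & ES).
  exists S. split; trivial. intros p x Hp s. rewrite <- (ES p x Hp s).
  change (fiber_tree x s <->
    exists y, set_of (V s) y /\ closure baire_space (fun p => d p x) y).
  rewrite closure_hit. split.
  - intros (y & k & Hy & E). exists y. split; trivial. exists k. exact E.
  - intros (y & [k E] & Hy). exists y, k. auto.
Qed.

Lemma fiber_tree_accept q (U : opens Xd) x : delta (opens Xd) q U ->
  set_of U x <-> exists s, fiber_tree x s /\ accept (graph q) (entry s).
Proof.
  intros HU. split.
  - intros Ux. destruct (name_surj d x) as [p Hp].
    destruct (proj1 (accept_finite Xd q U p x HU Hp) Ux) as [k Hk].
    exists (prefix p k). split; trivial. apply fiber_tree_prefix, Hp.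
  - intros (s & (p & k & Hp & <-) & Ha). apply (accept_finite Xd q U p x HU Hp). eauto.
Qed.

Hypothesis (Had : computably_admissible d).

(** The tree determines which open sets contain the point, and admissibility makes points with equal
    neighborhoods equal. *)
Lemma fiber_tree_inj x y : fiber_tree x = fiber_tree y -> x = y.
Proof.
  intros E. apply (proj1 Had). apply sig_eq, functional_extensionality. intros U.
  apply propositional_extensionality.
  destruct (name_surj (delta (opens Xd)) U) as [q Hq].
  change (set_of U x <-> set_of U y).
  apply (iff_trans (fiber_tree_accept q U x Hq)). rewrite E. symmetry.
  exact (fiber_tree_accept q U y Hq).
Qed.

Definition is_fiber_tree (A : opens_nat) : Prop := exists x, A = fiber_tree x.

(** An enumeration of the tree yields a name of the neighborhood filter, to which the computable
    inverse from admissibility is applied. *)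
Lemma computable_tree_point (g : subspace opens_nat is_fiber_tree -> Xd) :
  (forall A, proj1_sig A = fiber_tree (g A)) -> computable g.
Proof.
  intros Hg.
  assert (Hn : computable (fun A => nbhds Xd (g A))).
  { destruct (semidec_opens_name (fun p _ => exists s, ran (left_half p) s /\
      accept (graph (right_half p)) (entry s))) as [e He].
    { apply semidec_ex, semidec_and.
      - unfold ran, left_half. semidec_auto.
      - apply (semidec_accept (fun p _ => graph (right_half p)) (fun _ z => entry (sndn z)));
          unfold semidec_rel, graph, right_half; semidec_solve. }
    apply (computable_of_recursive _ (opens (opens Xd)) _ (opname e));
      [apply (recursive_opname e _ recursive_id)|].
    intros p A HA%delta_sets. apply He. intros q U HU.
    rewrite left_half_join, right_half_join, <- HA, Hg.
    apply (fiber_tree_accept q U (g A) HU). }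
  pose proof (computable_mv_comp _ _ _ _ _ Hn (proj2 Had)) as H.
  unfold computable. apply computable_mv_code in H as [c Hc].
  apply computable_mv_code. exists c. intros p A HA [y ->].
  destruct (Hc p A HA) as (q & y & Hq & Hy & E); [eauto|].
  exists q, y. split; [|split]; trivial. symmetry. apply (proj1 Had), E.
Qed.

Hypotheses (Hov : fiber_overt d) (Hdom : pi02 baire_space (dom d)).

Lemma semidec_pi02_is_fiber_tree : semidec_pi02 is_fiber_tree.
Proof.
  (* [S] enumerates the tree of [x] from any name of [x].  The last three conditions say
     that the branches in [dom d] are dense, that those enumerating all of [A] are dense,
     and that none of them enumerates more than [A]. *)
  destruct (semidec_fiber_tree Hov) as (S & HS & ES).
  destruct (semidec_of_pi02 _ Hdom) as (K & L & HK & HL & EKL).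
  destruct (finite_use S HS) as (S' & HS' & ES' & monoS).
  destruct (finite_use K HK) as (K' & HK' & EK & monoK).
  destruct (finite_use L HL) as (L' & HL' & EL & monoL).
  assert (app : forall M : nat -> nat -> Prop, semidec (fun _ z => M (fstn z) (sndn z)) ->
    forall F G, recursive F -> recursive G -> semidec (fun p n => M (F p n) (G p n))).
  { intros M HM F G HF HG. apply (semidec_ext _ _
    (semidec_comp _ _ HM (recursive_pr _ _ HF HG))).
    intros p n. prs. reflexivity. }
  assert (HP : semidec_pi02 (fun A =>
    (forall n : nat, n = n -> A 0) /\
    (forall s, A s -> A (tl s)) /\
    (forall s, A s -> exists v, A (cons v s)) /\
    (forall n, A (fstn n) /\ K' (fstn n) (sndn n) ->
      exists t, A t /\ (exists j, drop j t = fstn n) /\ L' t (sndn n)) /\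
    (forall n, A (fstn n) /\ A (sndn n) ->
      exists t, A t /\ (exists j, drop j t = fstn n) /\ S' t (sndn n)) /\
    (forall n, A (fstn n) /\ S' (fstn n) (sndn n) -> A (sndn n)))).
  { repeat apply semidec_pi02_and; apply semidec_pi02_imp; unfold semidec_set;
      repeat first [apply (app K' HK') | apply (app L' HL') | apply (app S' HS')
                   | semidec_rel_step]. }
  destruct HP as (M & N & HM & HN & EMN). exists M, N. split; [|split]; trivial.
  intros A. rewrite <- EMN. clear M N HM HN EMN app. split.
  - intros [x ->]. split; [|split; [|split; [|split; [|split]]]].
    + intros _ _. destruct (name_surj d x) as [p Hp]. apply (fiber_tree_prefix p x 0 Hp).
    + intros s (p & k & Hp & <-). exists p, (k - 1). split; trivial.
      symmetry. apply (drop_prefix p 1 k).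
    + intros s (p & k & Hp & <-). exists (p k), p, (Datatypes.S k). auto.
    + intros n [(p & k & Hp & E) Hn]. rewrite <- E in Hn |- *.
      (* The name [p] lies in the domain and its prefix triggers the condition, so some prefix of
         [p] fulfils it; a common longer prefix also extends the given node. *)
      assert (HLn : L p (sndn n)).
      { apply EKL; [exists x; exact Hp|]. apply EK. eauto. }
      apply EL in HLn as [l Hl]. exists (prefix p (k + l)).
      split; [apply fiber_tree_prefix, Hp|]. split; [apply extends_prefix; lia|].
      apply (monoL _ l); trivial. lia.
    + intros n [(p & k & Hp & E) Hn]. rewrite <- E.
      apply (ES p x Hp), ES' in Hn as [l Hl]. exists (prefix p (k + l)).
      split; [apply fiber_tree_prefix, Hp|]. split; [apply extends_prefix; lia|].
      apply (monoS _ l); trivial. lia.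
    + intros n [(p & k & Hp & E) Hn]. rewrite <- E in Hn.
      apply (ES p x Hp), ES'. eauto.
  - intros (A0 & Atl & Acons & AL & AS & Asub).
    assert (mono : forall M : nat -> nat -> Prop,
      (forall p k k' n, k <= k' -> M (prefix p k) n -> M (prefix p k') n) ->
      forall s t n, extends s t -> M s n -> M t n).
    { intros M HM s t n (p & k & k' & Lk & -> & ->)%extends_common. apply HM, Lk. }
    destruct (generic_branch A K' L' S' (mono K' monoK) (mono L' monoL))
      as (p & Ap & HpL & HpS); trivial; [exact (A0 0 eq_refl)| | |].
    { intros s n As Hs. specialize (AL (pr s n)). prs. exact (AL (conj As Hs)). }
    { intros s n As An. specialize (AS (pr s n)). prs. exact (AS (conj As An)). }
    (* Every domain condition triggered along the generic branch is met along it, so the branch is a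
       name. *)
    assert (dom d p) as [x Hx].
    { apply EKL. intros n [k Hk]%EK. apply EL, (HpL n k Hk). }
    (* The tree of [x] is what [S] enumerates from [p]: genericity supplies all of [A], and [Asub]
       excludes anything else. *)
    exists x. apply functional_extensionality. intros s.
    apply propositional_extensionality. rewrite (ES p x Hx s), ES'. split; [apply HpS|].
    intros [k Hk]. specialize (Asub (pr (prefix p k) s)). prs. auto.
Qed.

Lemma isomorphic_fiber_trees : isomorphic Xd (subspace opens_nat is_fiber_tree).
Proof.
  destruct (semidec_fiber_tree Hov) as (S & HS & ES).
  pose (g (A : subspace opens_nat is_fiber_tree) :=
    proj1_sig (constructive_indefinite_description _ (proj2_sig A))).
  assert (Hg : forall A, proj1_sig A = fiber_tree (g A)).
  { intros A. exact (proj2_sig (constructive_indefinite_description _ (proj2_sig A))). }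
  clearbody g.
  exists (fun x => exist is_fiber_tree (fiber_tree x) (ex_intro _ x eq_refl)). split.
  - apply (computable_into_sets Xd _ _ S HS). exact ES.
  - exists g. split; [apply computable_tree_point, Hg|]. split.
    + intros x. apply fiber_tree_inj. symmetry. apply (Hg (exist _ (fiber_tree x) _)).
    + intros A. apply sig_eq. symmetry. apply Hg.
Qed.

End FiberTrees.

Lemma admits_isomorphic (X : repspace) (d : representation X) :
  admits X d -> isomorphic X (RepSpace X d).
Proof. intros H. exists (fun x => x). exact H. Qed.

Theorem theorem12 (X : repspace) :
  ((exists R : nat -> nat -> Prop,
      transitive_rel R /\ ce_rel R /\ isomorphic X (RI R))
   <->
   (exists P : opens_nat -> Prop,
      pi02 opens_nat P /\ isomorphic X (subspace opens_nat P)))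
  /\
  ((exists P : opens_nat -> Prop,
      pi02 opens_nat P /\ isomorphic X (subspace opens_nat P))
   <->
   (exists d : representation X,
      admits X d /\ fiber_overt d /\ computably_admissible d /\
      pi02 baire_space (dom d))).
Proof.
  split; split.
  - intros (R & _ & HR & HX). exists (rounded_ideal R). split; trivial.
    apply semidec_pi02_pi02, semidec_pi02_rounded_ideal, HR.
  - intros (P & HP & HX). destruct (pi02_RI P HP) as (R & HT & HR & HI).
    exists R. split; [|split]; trivial. apply (isomorphic_trans _ _ _ HX HI).
  - intros (P & HP & HX). exact (pi02_representation X P HP HX).
  - intros (d & Hd & Hov & Had & Hdom). exists (is_fiber_tree X d). split.
    + apply semidec_pi02_pi02, semidec_pi02_is_fiber_tree; trivial.
    + apply (isomorphic_trans _ (RepSpace X d)); [apply admits_isomorphic, Hd|].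
      apply isomorphic_fiber_trees; trivial.
Qed.
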